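(* Let $(S,\Sigma,\lambda)$ and $(Y,\mu)$ be $\sigma$-finite measure spaces and suppose $B:Y\to\Sigma$ is a core map. Set $b=(\lambda\circ B)^*$, where $\lambda\circ B$ is the function $y\mapsto\lambda(B(y))$ on $Y$ and the non-increasing rearrangement is taken with respect to $\mu$. Then $b$ is a normal form parameter. If $1\le p\le\infty$ and $0<q\le\infty$, then $K_B:L^p_\lambda\to L^q_\mu$ is bounded if and only if $H_b:L^p\to L^q$ is bounded; moreover, the operator norm of $K_B:L^p_\lambda\to L^q_\mu$ is $N_{p,q}(b)$. If $1<p\le q<\infty$, then $K_B:L^p_\lambda\to L^q_\mu$ is compact if and only if $H_b:L^p\to L^q$ is compact.
   Context: For a $\sigma$-finite measure space with measure $\mu$, $L^+_\mu$ is the set of measurable functions with values in $[0,\infty]$ and $L^p_\mu$ ($0<p\le\infty$) is the usual Lebesgue space of complex-valued functions with its norm or quasi-norm. For Lebesgue measure $m$ on $(0,\infty)$ write $L^+$, $L^p$, $\|\cdot\|_p$. Core map: a map $B:Y\to\Sigma$ such that (I) the range of $B$ is totally ordered by inclusion; (II) for each $E\in\Sigma$, $y\mapsto\lambda(E\cap B(y))$ is $\mu$-measurable; (III) $\bigcup_{y\in Y}B(y)=\bigcup_{y\in Y_0}B(y)$ for some countable $Y_0\subseteq Y$; (IV) $\lambda(B(y))<\infty$ for all $y\in Y$. Abstract Hardy operator: $K_Bg(y)=\int_{B(y)}g\,d\lambda$ for $g\in L^+_\lambda$. Normal form parameter: a non-increasing function $b:(0,\infty)\to[0,\infty]$. Normal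 form Hardy operator: $H_bf(x)=\int_0^{b(x)}f(t)\,dt$ for $f\in L^+$. $N_{p,q}(b)\in[0,\infty]$ is the smallest $C$ such that $\|H_bf\|_q\le C\|f\|_p$ for all $f\in L^+$ with $\|f\|_p<\infty$, i.e. the operator norm of $H_b:L^p\to L^q$, taken to be $\infty$ if $H_b$ is not bounded; likewise the operator norm of $K_B$ is the smallest $C\in[0,\infty]$ with $\|K_Bg\|_{L^q_\mu}\le C\|g\|_{L^p_\lambda}$ for all non-negative $g\in L^p_\lambda$. When such an operator is bounded it is extended linearly to the whole (complex) Lebesgue space, denoted by the same symbol; boundedness and compactness refer to this extension. Rearrangement: for a $\mu$-measurable $f$ on $Y$, $\mu_f(t)=\mu\{y\in Y:|f(y)|>t\}$ for $t>0$, and $f^*(x)=\sup\{t>0:x<\mu_f(t)\}$ for $x>0$, with $\sup\emptyset=0$. *)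

(* Defs.v *)
From HB Require Import structures.
From mathcomp Require Import all_boot all_order all_algebra.
From mathcomp Require Import all_classical all_reals all_analysis measurable_realfun.
From mathcomp.real_closed Require Import complex.
Import Order.TTheory GRing.Theory Num.Theory.
Import numFieldNormedType.Exports.

Set Implicit Arguments.
Unset Strict Implicit.
Unset Printing Implicit Defensive.

Local Open Scope classical_set_scope.
Local Open Scope ring_scope.
Local Open Scope ereal_scope.

(* A function on (0, oo) is represented by a function on R whose values at
   x <= 0 are irrelevant: Lebesgue measure on (0, oo) is the measure
   A |-> |A n (0, oo)| on the Borel sets of R. *)
Definition lebesgue_pos (R : realType) :
    {measure set (measurableTypeR R) -> \bar R} :=
  mrestr (@lebesgue_measure R) (measurable_itv `]0%R, +oo[).

Section complex_Lebesgue_spaces.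
Context d (T : measurableType d) (R : realType).
Variable mu : {measure set T -> \bar R}.

Definition complex_measurable (g : T -> R[i]) : Prop :=
  measurable_fun setT (fun x => complex.Re (g x)) /\
  measurable_fun setT (fun x => complex.Im (g x)).

Definition complex_Lnorm (p : \bar R) (g : T -> R[i]) : \bar R :=
  Lnorm mu p (fun x => (ComplexField.Normc.normc (g x))%:E).

Definition in_complex_Lp (p : \bar R) (g : T -> R[i]) : Prop :=
  complex_measurable g /\ complex_Lnorm p g < +oo.

End complex_Lebesgue_spaces.

(* Operators are first given on non-negative functions, as maps
   K : (S -> \bar R) -> (Y -> \bar R). *)
Section positive_operators.
Context d (S : measurableType d) d' (Y : measurableType d') (R : realType).
Variables (lambda : {measure set S -> \bar R}) (mu : {measure set Y -> \bar R}).
Implicit Types (K : (S -> \bar R) -> (Y -> \bar R)) (p q C : \bar R).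

Definition norm_bound K p q C : Prop :=
  forall g : S -> \bar R,
    measurable_fun setT g -> (forall s, 0 <= g s) -> Lnorm lambda p g < +oo ->
    Lnorm mu q (K g) <= C * Lnorm lambda p g.

Definition operator_norm K p q : \bar R :=
  ereal_inf [set C | 0 <= C /\ norm_bound K p q C].

Definition real_extension K (u : S -> R) (y : Y) : R :=
  (fine (K (funepos (EFin \o u)) y) - fine (K (funeneg (EFin \o u)) y))%R.

(* The linear extension of K to complex functions. If K is bounded and g is in
   L^p then the four values of K involved are finite at almost every y, so that
   the convention fine +oo = 0 only matters on a null set. *)
Definition complex_extension K (g : S -> R[i]) (y : Y) : R[i] :=
  Complex (real_extension K (fun s => complex.Re (g s)) y)
          (real_extension K (fun s => complex.Im (g s)) y).

(* The first clause makes the extension to the complex space L^p meaningful;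
   the second says that this extension is bounded from L^p to L^q. *)
Definition bounded_operator K p q : Prop :=
  (exists C : R, norm_bound K p q C%:E) /\
  (exists C : R, forall g : S -> R[i], in_complex_Lp lambda p g ->
     in_complex_Lp mu q (complex_extension K g) /\
     complex_Lnorm mu q (complex_extension K g)
       <= C%:E * complex_Lnorm lambda p g).

Definition compact_operator K p q : Prop :=
  bounded_operator K p q /\
  forall g : nat -> S -> R[i],
    (forall n, in_complex_Lp lambda p (g n)) ->
    (exists M : R, forall n, complex_Lnorm lambda p (g n) <= M%:E) ->
    exists (k : nat -> nat) (h : Y -> R[i]),
      [/\ {homo k : m n / (m < n)%N},
          in_complex_Lp mu q h &
          (fun n => complex_Lnorm mu q
             (fun y => (complex_extension K (g (k n)) y - h y)%R))
            @ \oo --> 0].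

End positive_operators.

Record core_map (R : realType) d (S : measurableType d)
    d' (Y : measurableType d') (lambda : {measure set S -> \bar R})
    (B : Y -> set S) : Prop := CoreMap {
  core_map_measurable : forall y, measurable (B y) ;
  core_map_total : forall y z, B y `<=` B z \/ B z `<=` B y ;
  core_map_measurable_fun : forall E : set S, measurable E ->
    measurable_fun setT (fun y => lambda (E `&` B y)) ;
  core_map_countable : exists2 Y0 : set Y, countable Y0 &
    \bigcup_(y in setT) B y = \bigcup_(y in Y0) B y ;
  core_map_finite : forall y, lambda (B y) < +oo }.

Definition hardy_operator (R : realType) d (S : measurableType d) (Y : Type)
    (lambda : {measure set S -> \bar R}) (B : Y -> set S)
    (g : S -> \bar R) (y : Y) : \bar R :=
  \int[lambda]_(s in B y) g s.

Definition normal_form_parameter (R : realType) (b : R -> \bar R) : Prop :=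
  (forall x : R, (0 < x)%R -> 0 <= b x) /\
  (forall x y : R, (0 < x)%R -> (x <= y)%R -> b y <= b x).

Definition normal_form_operator (R : realType) (b : R -> \bar R)
    (f : R -> \bar R) (x : R) : \bar R :=
  if (0 < x)%R
  then \int[lebesgue_measure]_(t in [set t : R | (0 < t)%R /\ t%:E < b x]) f t
  else 0.

Definition normal_form_norm (R : realType) (p q : \bar R) (b : R -> \bar R)
    : \bar R :=
  operator_norm (lebesgue_pos R) (lebesgue_pos R) (normal_form_operator b) p q.

Definition distribution_function (R : realType) d (Y : measurableType d)
    (mu : {measure set Y -> \bar R}) (f : Y -> \bar R) (t : R) : \bar R :=
  mu [set y | t%:E < `|f y|].

(* Adjoining 0 implements the convention sup set0 = 0. *)
Definition rearrangement (R : realType) d (Y : measurableType d)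
    (mu : {measure set Y -> \bar R}) (f : Y -> \bar R) (x : R) : \bar R :=
  ereal_sup (0 |` [set t%:E | t in
    [set t : R | (0 < t)%R /\ x%:E < distribution_function mu f t]]).

(* Main.v *)
(* All the sets B(y) belong to one chain, so up to null sets B(y) is determined by
   lambda(B(y)). Replacing a function by its averages over the successive
   differences of a finite chain does not increase its L^p norm (Jensen) and keeps
   its integrals over the sets of the chain; after a passage to the limit, K_B and
   the operator sending f to F o (lambda o B), where F(z) is the integral of f over
   (0, z), satisfy the same norm inequalities. Since F is non-decreasing and
   left-continuous and b = (lambda o B)^* is equimeasurable with lambda o B, the
   functions F o (lambda o B) and H_b f = F o b have the same L^q norm.
   For p > 1, Hoelder's inequality gives the modulus of continuity
   |K_B g(y) - K_B g(z)| <= ||g||_p |lambda(B(y)) - lambda(B(z))|^(1 - 1/p), so a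
   bounded sequence has a subsequence whose images converge pointwise. Hence a
   bounded K_B is compact if and only if the integrals of (K_B g)^q over the sets
   where lambda(B(y)) <= 1/n or lambda(B(y)) > n tend to 0 uniformly on the
   non-negative unit ball of L^p. This condition is transferred to H_b in the same
   way as the norm inequalities. *)
From HB Require Import structures.
Require Import Defs.
From mathcomp Require Import all_boot all_order all_algebra.
From mathcomp Require Import all_classical all_reals all_analysis.
From mathcomp Require Import measurable_realfun ess_sup_inf ring lra.
From mathcomp.real_closed Require Import complex.
Import Order.TTheory GRing.Theory Num.Theory.
Import numFieldNormedType.Exports.

Set Implicit Arguments.
Unset Strict Implicit.
Unset Printing Implicit Defensive.

Local Open Scope classical_set_scope.
Local Open Scope ring_scope.
Local Open Scope ereal_scope.

(** * L^p norms and distribution functions *)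

(** The transfer is one symmetric statement, [chain_transfer], about two chains with the same index
    set and the same measures. The intervals (0, lambda(B(y))), indexed by the points of [Y], are
    such a partner for [B], and exchanging the two chains gives the reverse inequality. The function
    that replaces g depends on the finite subchain, and no limit of these functions is taken: only
    the common bound survives, by monotone convergence of the images. So atoms of lambda and jumps
    of lambda o B cause no trouble. The measure on [Y] is arbitrary there, which lets a tail
    integral be treated as a norm for [mu] restricted to the tail. The compactness criterion speaks
    of chains of sets of finite measure; to apply it to H_b, finiteness of b is derived from
    boundedness of K_B. The tails contain the set where lambda o B <= 1/n, which may have infinite
    measure, so equality of the tail integrals is obtained by subtracting the middle part from a
    finite total. *)

Lemma ereal_nondecreasing_le_cvg (R : realType) (u : nat -> \bar R) l n :
  nondecreasing_seq u -> u @ \oo --> l -> u n <= l.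
Proof.
move=> ndu ul; rewrite -(cvg_lim _ ul)//.
rewrite (cvg_lim _ (ereal_nondecreasing_cvgn ndu))//.
by apply: ereal_sup_ubound; exists n.
Qed.

Section Lnorm_facts.
Context d (T : measurableType d) (R : realType).
Variable mu : {measure set T -> \bar R}.
Implicit Types (u v : T -> \bar R) (p c : \bar R) (r : R).

Lemma measurable_abse_poweR (D : set T) u r : measurable_fun D u ->
  measurable_fun D (fun x => `|u x| `^ r).
Proof.
move=> mu_; apply: (measurableT_comp (measurable_poweR r)).
exact: measurableT_comp.
Qed.

Lemma measurable_poweR_comp (D : set T) u r : measurable_fun D u ->
  measurable_fun D (fun x => u x `^ r).
Proof. by move=> mu_; apply: (measurableT_comp (measurable_poweR r)). Qed.

Lemma ge0_poweR_le (x y : \bar R) r : (0 <= r)%R -> 0 <= x -> x <= y ->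
  x `^ r <= y `^ r.
Proof.
move=> r0 x0 xy; apply: gt0_ler_poweR => //; rewrite in_itv/= leey andbT//.
exact: le_trans xy.
Qed.

Lemma poweR_inv_le (x c : \bar R) r : (0 < r)%R -> 0 <= x -> 0 <= c ->
  (x `^ r^-1 <= c) = (x <= c `^ r).
Proof.
move=> r0 x0 c0; apply/idP/idP => h.
- rewrite -(poweRe1 x0) -(mulVf (lt0r_neq0 r0)) poweRrM.
  by apply: ge0_poweR_le => //; [exact: ltW|exact: poweR_ge0].
- rewrite -(poweRe1 c0) -(mulfV (lt0r_neq0 r0)) poweRrM.
  by apply: ge0_poweR_le => //; rewrite invr_ge0 ltW.
Qed.

Lemma Lnorm_leP u r c : (0 < r)%R -> 0 <= c ->
  (Lnorm mu r%:E u <= c) = (\int[mu]_x `|u x| `^ r <= c `^ r).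
Proof.
move=> r0 c0; rewrite unlock poweR_inv_le//.
by apply: integral_ge0 => x _; exact: poweR_ge0.
Qed.

Lemma Lnorm_lty u r : (0 < r)%R ->
  (Lnorm mu r%:E u < +oo) = (\int[mu]_x `|u x| `^ r < +oo).
Proof.
move=> r0; apply/idP/idP => h.
- rewrite -poweR_Lnorm ?gt_eqF//; exact: poweR_lty.
- by rewrite unlock poweR_lty.
Qed.

Lemma ae_abse_le_Lnormy u : measurable_fun setT u ->
  {ae mu, forall x, `|u x| <= Lnorm mu +oo u}.
Proof.
(* [Lnorm] at +oo is 0 by definition when [mu setT] is 0; the claim then holds because the whole
   space is null. *)
move=> mu_; rewrite unlock; case: ifPn => [_|muT]; first exact: ess_sup_ge.
have muT0 : mu setT = 0.
  by apply/eqP; rewrite eq_le measure_ge0 andbT leNgt.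
by exists setT; split.
Qed.

Lemma Lnormy_le u c : 0 <= c -> {ae mu, forall x, `|u x| <= c} ->
  Lnorm mu +oo u <= c.
Proof. by move=> c0 uc; rewrite unlock; case: ifPn => // _; exact/ess_supP. Qed.

(** Reads the sup norm off the distribution function, so that equimeasurable functions can be
    compared at exponent +oo as well. *)
Lemma Lnormy_leP u c : measurable_fun setT u -> 0 <= c ->
  Lnorm mu +oo u <= c <-> mu [set x | c < `|u x|] = 0.
Proof.
move=> mfu c0.
have -> : [set x | c < `|u x|] = (abse \o u) @^-1` `]c, +oo[.
  by apply/seteqP; split => x /=; rewrite in_itv/= andbT.
rewrite -ae_le_measureP; last exact: measurableT_comp.
split => h; last exact: Lnormy_le.
by apply: filterS (ae_abse_le_Lnormy mfu) => x /le_trans; exact.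
Qed.

Lemma ae_le_Lnorm u v p : 0 < p -> measurable_fun setT u ->
  measurable_fun setT v -> {ae mu, forall x, `|u x| <= `|v x|} ->
  Lnorm mu p u <= Lnorm mu p v.
Proof.
case: p => [r| |]//; last first.
  move=> _ mfu mfv uv; apply: Lnormy_le; first exact: Lnorm_ge0.
  apply: filterS2 uv (ae_abse_le_Lnormy mfv) => x; exact: le_trans.
rewrite lte_fin => r0 mfu mfv uv.
rewrite Lnorm_leP ?Lnorm_ge0// poweR_Lnorm ?gt_eqF//.
apply: ae_ge0_le_integral => //; do ?exact: measurable_abse_poweR;
  do ?by move=> *; exact: poweR_ge0.
by apply: filterS uv => x uv _; apply: ge0_poweR_le => //; exact: ltW.
Qed.

Lemma le_Lnorm u v p : 0 < p -> measurable_fun setT u ->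
  measurable_fun setT v -> (forall x, `|u x| <= `|v x|) ->
  Lnorm mu p u <= Lnorm mu p v.
Proof. by move=> p0 mfu mfv uv; apply: ae_le_Lnorm => //; exact: aeW. Qed.

Lemma Lnorm_scale u p (k : R) : 0 < p -> (0 <= k)%R -> measurable_fun setT u ->
  Lnorm mu p (fun x => k%:E * u x) = k%:E * Lnorm mu p u.
Proof.
case: p => [r| |]//.
  rewrite lte_fin => r0 k0 mfu; rewrite !unlock.
  under eq_integral do rewrite abseM poweRM//.
  rewrite ge0_integralZl//; last 3 first.
  - exact: measurable_abse_poweR.
  - by move=> *; exact: poweR_ge0.
  - exact: poweR_ge0.
  rewrite poweRM ?poweR_ge0//; last by apply: integral_ge0 => *; exact: poweR_ge0.
  by rewrite -poweRrM mulfV ?gt_eqF// poweRe1 ?gee0_abs.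
move=> _ k0 mfu; rewrite !unlock; case: ifPn => [m0|]; last by rewrite mule0.
rewrite -ess_supZl//; congr ess_sup; apply/funext => x /=.
by rewrite abseM gee0_abs.
Qed.

(** Monotone convergence for finite exponents, a countable union of null sets for +oo. No triangle
    inequality enters, so exponents below 1 are covered. *)
Lemma le_Lnorm_sup (u_ : nat -> T -> \bar R) u p c : 0 < p -> 0 <= c ->
  (forall n, measurable_fun setT (u_ n)) -> (forall n x, 0 <= u_ n x) ->
  (forall x, nondecreasing_seq (u_ ^~ x)) ->
  (forall x, u_ n x @[n --> \oo] --> u x) ->
  (forall n : nat, Lnorm mu p (u_ n) <= c) -> Lnorm mu p u <= c.
Proof.
move=> p0 c0 mfu u0 ndu uu_ uc.
have mfu' : measurable_fun setT u by apply: emeasurable_fun_cvg mfu _ => x _.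
have u'0 x : 0 <= u x.
  rewrite -(cvg_lim _ (uu_ x))//; apply: lime_ge; last exact: nearW.
  exact: (cvgP _ (uu_ x)).
have uu' n x : u_ n x <= u x.
  exact: ereal_nondecreasing_le_cvg (uu_ x).
have : forall n : nat, Lnorm mu p (u_ n) <= c by [].
case: p p0 uc => [r| |]//.
  rewrite lte_fin => r0 _ uc; rewrite Lnorm_leP//.
  (* [L] is the limit of the r-th powers. Only u^r <= [L] is proved, by taking r-th roots, which
     avoids continuity of the power function at +oo. *)
  pose L x := limn (fun n => u_ n x `^ r).
  have ndL x : nondecreasing_seq (fun n => u_ n x `^ r).
    by move=> m n mn; apply: ge0_poweR_le => //; [exact: ltW|exact: ndu].
  have cL x : cvgn (fun n => u_ n x `^ r).
    exact: ereal_nondecreasing_is_cvgn.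
  have L0 x : 0 <= L x.
    by apply: lime_ge => //; apply: nearW => n; exact: poweR_ge0.
  have uL x : `|u x| `^ r <= L x.
    rewrite gee0_abs// -[X in _ `^ X]invrK poweR_inv_le ?invr_gt0//.
    rewrite -(cvg_lim _ (uu_ x))//; apply: lime_le.
      exact: (cvgP _ (uu_ x)).
    apply: nearW => n; rewrite -poweR_inv_le ?invr_gt0// invrK.
    exact: ereal_nondecreasing_le_cvg (cL x).
  apply: (@le_trans _ _ (\int[mu]_x L x)).
    apply: ge0_le_integral => //;
      [by move=> *; exact: poweR_ge0|exact: measurable_abse_poweR|].
    apply: emeasurable_fun_cvg => [n|x _]; last exact: cL.
    exact: measurable_poweR_comp.
  rewrite monotone_convergence//; last first.
  - by move=> n x _; exact: poweR_ge0.
  - by move=> n; exact: measurable_poweR_comp.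
  apply: lime_le.
    apply: ereal_nondecreasing_is_cvgn => m n mn.
    by apply: ge0_le_integral => //; do ?exact: measurable_poweR_comp; move=> x _;
      [exact: poweR_ge0|exact: ndL].
  apply: nearW => n; have := uc n; rewrite Lnorm_leP//.
  by under eq_integral do rewrite gee0_abs//.
move=> _ uc _; apply: Lnormy_le => //.
have : {ae mu, forall x, forall n, `|u_ n x| <= c}.
  apply/ae_foralln => n; apply: filterS (ae_abse_le_Lnormy (mfu n)) => x.
  by move/le_trans; apply.
apply: filterS => x uxc; rewrite gee0_abs// -(cvg_lim _ (uu_ x))//.
apply: lime_le; first exact: (cvgP _ (uu_ x)).
by apply: nearW => n; rewrite -(gee0_abs (u0 n x)).
Qed.

End Lnorm_facts.

(** * Lebesgue measure on the half-line and the layer-cake formula *)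

Lemma lebesgue_posE (R : realType) (A : set R) :
  lebesgue_pos R A = lebesgue_measure (A `&` `]0%R, +oo[).
Proof. by []. Qed.

Lemma sigma_finite_lebesgue_pos (R : realType) :
  sigma_finite setT (lebesgue_pos R).
Proof.
have [F UF Foo] := @sigma_finiteT _ _ _ (@lebesgue_measure R).
exists F => // i; have [mF Fi] := Foo i; split => //.
rewrite lebesgue_posE; apply: le_lt_trans Fi.
by rewrite le_measure// inE//; exact: measurableI.
Qed.

(* The same measure under a new head symbol, to which the hypothesis of
   sigma-finiteness can be attached as a structure. *)
Definition repack d (T : measurableType d) (R : realType)
  (mu : {measure set T -> \bar R}) & sigma_finite setT mu : set T -> \bar R := mu.

HB.instance Definition _ d (T : measurableType d) (R : realType)
    (mu : {measure set T -> \bar R}) (H : sigma_finite setT mu) :=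
  isMeasure.Build _ _ _ (repack H) (measure0 mu) (measure_ge0 mu)
    (@measure_semi_sigma_additive _ _ _ mu).

HB.instance Definition _ d (T : measurableType d) (R : realType)
    (mu : {measure set T -> \bar R}) (H : sigma_finite setT mu) :=
  @Measure_isSigmaFinite.Build _ _ _ (repack H) H.

Lemma measurable_superlevel d (T : measurableType d) (R : realType)
    (u : T -> \bar R) c : measurable_fun setT u ->
  measurable [set x | c < u x].
Proof.
by move=> mfu; rewrite -[X in measurable X]setTI; exact: emeasurable_fun_o_infty.
Qed.

Lemma lebesgue_measure_oo (R : realType) (c : \bar R) : 0 <= c ->
  lebesgue_measure [set s : R | (0 < s)%R /\ s%:E < c] = c.
Proof.
case: c => [c| |]// c0.
- rewrite (_ : [set s | _] = `]0%R, c[%classic); last first.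
    by apply/seteqP; split => x /=; rewrite in_itv/= lte_fin => /andP.
  rewrite lebesgue_measure_itv/= lte_fin; case: ltP => [_|]; first by rewrite sube0.
  by move=> c0'; apply/eqP; rewrite eq_le c0/= lee_fin.
- rewrite (_ : [set s | _] = `]0%R, +oo[%classic); last first.
    apply/seteqP; split => x /=; rewrite in_itv/= andbT ?ltry; first by case.
    by [].
  by rewrite lebesgue_measure_itv/= ltry.
Qed.

Section layer_cake.
Context (R : realType).

Lemma layer_cake d (T : measurableType d)
    (mu : {measure set T -> \bar R}) (u : T -> \bar R) :
  sigma_finite setT mu -> measurable_fun setT u -> (forall x, 0 <= u x) ->
  \int[mu]_x u x = \int[lebesgue_measure]_(s in [set s : R | (0 < s)%R])
    mu [set x | s%:E < u x].
Proof.
move=> sf mfu u0; pose m := repack sf.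
rewrite (@eq_measure_integral _ _ _ _ m)//.
(* The region under the graph of [u]: its section over [x] has length [u x], its section at height
   [s] is a superlevel set. Tonelli equates the two iterated integrals. *)
pose A := [set z : T * measurableTypeR R | (0 < z.2)%R /\ z.2%:E < u z.1].
have mA : measurable A.
  rewrite (_ : A = [set z | 0 < z.2%:E] `&` [set z | z.2%:E < u z.1]); last first.
    by apply/seteqP; split => z /=.
  have m2 : measurable_fun [set: T * measurableTypeR R] (fun z => z.2%:E).
    exact/measurable_EFinP.
  apply: measurableI; rewrite -[X in measurable X]setTI.
    exact: measurable_lte.
  by apply: measurable_lte => //; exact: measurableT_comp.
have := @indic_fubini_tonelli _ _ T (measurableTypeR R) R m (@lebesgue_measure R) A mA.
rewrite indic_fubini_tonelli_FE// indic_fubini_tonelli_GE//= => h.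
transitivity (\int[m]_x lebesgue_measure (xsection A x)).
  apply: eq_integral => x _; rewrite -[LHS]lebesgue_measure_oo//.
  by congr lebesgue_measure; apply/seteqP; split => s /=; rewrite /xsection/= inE.
rewrite h [RHS]integral_mkcond; apply: eq_integral => s _.
rewrite patchE; case: ifPn => [|]; rewrite ?inE ?notin_setE/= => s0.
  by congr (mu _); apply/seteqP; split => x /=; rewrite /ysection/= inE => // -[].
rewrite (_ : ysection _ _ = set0) ?measure0//; apply/seteqP; split => x //=.
by rewrite /ysection/= inE => -[/= /s0].
Qed.

(** Either norm is determined by the distribution function: through the layer-cake formula at finite
    exponents, through [Lnormy_leP] at +oo. *)
Lemma eq_distribution_Lnorm d (T : measurableType d)
    (mu : {measure set T -> \bar R}) (u : T -> \bar R)
    d' (X : measurableType d')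
    (nu : {measure set X -> \bar R}) (v : X -> \bar R) p :
  0 < p -> sigma_finite setT mu -> sigma_finite setT nu ->
  measurable_fun setT u -> (forall x, 0 <= u x) ->
  measurable_fun setT v -> (forall x, 0 <= v x) ->
  (forall s : R, (0 <= s)%R -> mu [set x | s%:E < u x] = nu [set x | s%:E < v x]) ->
  Lnorm mu p u = Lnorm nu p v.
Proof.
move=> p0 sfmu sfnu mfu u0 mfv v0 uv.
have absu : abse \o u = u by apply/funext => x /=; rewrite gee0_abs.
have absv : abse \o v = v by apply/funext => x /=; rewrite gee0_abs.
case: p p0 => [r| |]//; last first.
  move=> _; apply/eqP; rewrite eq_le; apply/andP; split.
  - apply/Lnormy_leP => //; first exact: Lnorm_ge0.
    under eq_fun do rewrite gee0_abs//.
    have := Lnorm_ge0 nu +oo v.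
    (* This trivial inequality becomes, by [Lnormy_leP], the nullity of the superlevel set of [v] at
       its own norm. A norm +oo is treated apart, since [uv] speaks of real levels only. *)
    have : Lnorm nu +oo v <= Lnorm nu +oo v by [].
    move=> /Lnormy_leP -/(_ mfv (Lnorm_ge0 _ _ _)).
    under eq_fun do rewrite gee0_abs//.
    case: (Lnorm nu +oo v) => [s| |]//.
      by rewrite lee_fin => h s0; rewrite uv.
    move=> _ _; rewrite (_ : [set x | _] = set0) ?measure0//.
    by apply/seteqP; split => x //=; rewrite ltNge leey.
  - apply/Lnormy_leP => //; first exact: Lnorm_ge0.
    under eq_fun do rewrite gee0_abs//.
    have := Lnorm_ge0 mu +oo u.
    have : Lnorm mu +oo u <= Lnorm mu +oo u by [].
    move=> /Lnormy_leP -/(_ mfu (Lnorm_ge0 _ _ _)).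
    under eq_fun do rewrite gee0_abs//.
    case: (Lnorm mu +oo u) => [s| |]//.
      by rewrite lee_fin => h s0; rewrite -uv.
    move=> _ _; rewrite (_ : [set x | _] = set0) ?measure0//.
    by apply/seteqP; split => x //=; rewrite ltNge leey.
rewrite lte_fin => r0; rewrite !unlock; congr (_ `^ _).
rewrite !layer_cake//; do ?exact: measurable_abse_poweR;
  do ?by move=> *; exact: poweR_ge0.
apply: eq_integral => s; rewrite inE/= => s0.
have E d0 (Z : measurableType d0) (w : Z -> \bar R) : (forall x, 0 <= w x) ->
    [set x | s%:E < `|w x| `^ r] = [set x | (s `^ r^-1)%:E < w x].
  move=> w0; apply/seteqP; split => x /=; rewrite !ltNge gee0_abs//; apply: contra.
    move=> h; rewrite -[X in _ `^ X]invrK poweR_inv_le ?invr_gt0//.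
    by rewrite lee_fin ltW.
  by move=> h; rewrite -poweR_EFin -poweR_inv_le ?invr_gt0 ?invrK// ?lee_fin ltW.
by rewrite !E// uv// powR_ge0.
Qed.
End layer_cake.

(** * Averaging along a chain of sets *)

(** The graph of x^r lies above its tangent at c. This is Young's inequality for x and c^(r-1) with
    the exponents r and r/(r-1). *)
Lemma powR_tangent (R : realType) (x c r : R) : (0 <= x)%R -> (0 <= c)%R ->
  (1 <= r)%R -> (r * (c `^ (r - 1) * x) <= x `^ r + (r - 1) * c `^ r)%R.
Proof.
move=> x0 c0; rewrite le_eqVlt => /predU1P[<-|r1].
  by rewrite subrr powRr0 !powRr1// !mul1r mul0r addr0.
have r0 : (0 < r)%R by lra.
have r10 : (0 < r - 1)%R by lra.
have q0 : (0 < r / (r - 1))%R by rewrite divr_gt0.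
have := @conjugate_powR _ x (c `^ (r - 1))%R r (r / (r - 1))%R x0 (powR_ge0 _ _) r0 q0.
rewrite invf_div; have -> : (r^-1 + (r - 1) / r = 1)%R by field; lra.
move=> /(_ erefl); rewrite -powRrM.
have -> : ((r - 1) * (r / (r - 1)) = r)%R by field; lra.
move=> h; rewrite (mulrC (c `^ _)%R).
have : (r * (x * c `^ (r - 1)) <= r * (x `^ r / r + c `^ r * ((r - 1) / r)))%R.
  by rewrite ler_pM2l.
move/le_trans; apply; rewrite mulrDr le_eqVlt; apply/orP; left; apply/eqP.
by field; lra.
Qed.

Section average.
Context (R : realType) d1 (S1 : measurableType d1) d2 (S2 : measurableType d2).
Variables (l1 : {measure set S1 -> \bar R}) (l2 : {measure set S2 -> \bar R}).

(** [c] is the mean of [g] over [D2], or 0 if [D2] is null; [D1] enters only through its measure.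
    The clause on powers is Jensen's inequality, got by integrating the tangent inequality at
    [c]. *)
Lemma average_step (D1 : set S1) (D2 : set S2) (g : S2 -> \bar R) :
  measurable D1 -> measurable D2 -> l1 D1 = l2 D2 -> l2 D2 < +oo ->
  measurable_fun setT g -> (forall x, 0 <= g x) ->
  exists c, [/\ 0 <= c, c * l1 D1 = \int[l2]_(x in D2) g x,
    forall r : R, (1 <= r)%R -> c `^ r * l1 D1 <= \int[l2]_(x in D2) g x `^ r
    & forall M, 0 <= M -> {ae l2, forall x, g x <= M} -> c <= M].
Proof.
move=> mD1 mD2 -> D2oo mfg g0.
have mfD h : measurable_fun setT h -> measurable_fun D2 h.
  by move=> /measurable_funS; apply.
have mgr r := measurable_poweR_comp r mfg.
have [D20|D20] := eqVneq (l2 D2) 0.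
  exists 0; split => //; first by rewrite mul0e null_set_integral//; exact: mfD.
  by move=> r r1; rewrite D20 mule0; apply: integral_ge0 => *; exact: poweR_ge0.
have Dfin : l2 D2 \is a fin_num by rewrite ge0_fin_numE.
have Dgt0 : 0 < l2 D2 by rewrite lt0e D20/=.
pose l := fine (l2 D2).
have lE : l2 D2 = l%:E by rewrite fineK.
have l0 : (0 < l)%R by rewrite -lte_fin -lE.
pose I := \int[l2]_(x in D2) g x.
have I0 : 0 <= I by apply: integral_ge0.
have cE : I * (l^-1)%:E * l%:E = I.
  by rewrite -muleA -EFinM mulVf ?mule1// gt_eqF.
exists (I * (l^-1)%:E); rewrite lE cE; split => //.
- by rewrite mule_ge0// lee_fin invr_ge0 ltW.
- move=> r r1; have r0 : (0 < r)%R by rewrite (lt_le_trans ltr01).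
  (* If the integral of [g] is infinite, so is that of g^r, because g <= 1 + g^r and [D2] has finite
     measure. *)
  have [Ioo|] := ltP I +oo; last first.
    rewrite leye_eq => /eqP Ioo.
    suff -> : \int[l2]_(x in D2) (g x `^ r) = +oo by rewrite leey.
    apply/eqP; rewrite -leye_eq.
    have : I <= \int[l2]_(x in D2) (cst 1 x + g x `^ r).
      apply: ge0_le_integral => //; first exact: mfD.
        by apply: mfD; apply: emeasurable_funD.
      move=> x _ /=; have [g1|g1] := leP (g x) 1.
        by rewrite (le_trans g1)// leeDl// poweR_ge0.
      apply: le_trans (leeDr _ _) => //; rewrite -[leLHS]poweRe1//.
      case: (g x) g1 => [s| |]//.
        by rewrite lte_fin !poweR_EFin lee_fin => s1; rewrite ler_powR// ltW.
      by move=> _; rewrite !poweRyr ?gt_eqF.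
    rewrite ge0_integralD//; [|by move=> *; exact: poweR_ge0|exact: mfD].
    rewrite integral_cst// mul1e Ioo lE.
    by case: (integral _ _ _).
  have If : I \is a fin_num by rewrite ge0_fin_numE.
  pose c := (fine I / l)%R.
  have c0 : (0 <= c)%R by rewrite divr_ge0 ?fine_ge0// ltW.
  have IE : I = (c * l)%:E by rewrite /c -mulrA mulVf ?gt_eqF// mulr1 fineK.
  have -> : I * (l^-1)%:E = c%:E.
    by rewrite IE -EFinM -mulrA mulfV ?gt_eqF// mulr1.
  (* The slope of the tangent to x^r at [c]. Since [g] has mean [c], the linear term integrates to r
     c^r l, and c^r l remains after cancellation. *)
  pose k := (r * c `^ (r - 1))%R.
  have k0 : (0 <= k)%R by rewrite mulr_ge0 ?powR_ge0// ltW.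
  have : \int[l2]_(x in D2) (k%:E * g x) <=
      \int[l2]_(x in D2) (g x `^ r + cst ((r - 1) * c `^ r)%:E x).
    apply: ge0_le_integral => //.
    - by move=> x _; rewrite mule_ge0.
    - by apply: mfD; exact: measurable_funeM.
    - by apply: mfD; exact: emeasurable_funD.
    - move=> x _ /=; case: (g x) (g0 x) => [s| |]//.
      + rewrite lee_fin => s0; rewrite poweR_EFin -EFinM -EFinD lee_fin /k.
        by rewrite -mulrA powR_tangent.
      + by move=> _; rewrite poweRyr ?gt_eqF// addye// leey.
  have r10 : (0 <= r - 1)%R by rewrite subr_ge0.
  rewrite ge0_integralZl//; last exact: mfD.
  have gr0 x : D2 x -> 0 <= g x `^ r by move=> _; exact: poweR_ge0.
  have gc0 x : D2 x -> 0 <= cst ((r - 1) * c `^ r)%:E x.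
    by move=> _; rewrite lee_fin mulr_ge0// powR_ge0.
  have mgrD := mfD _ _ _ (mgr r).
  rewrite ge0_integralD//.
  rewrite integral_cst// -/I IE lE -!EFinM.
  have ccE : (c `^ (r - 1) * c = c `^ r)%R.
    have [->|cn0] := eqVneq c 0%R; first by rewrite mulr0 powR0 ?gt_eqF.
    by rewrite -[X in (_ * X)%R]powRr1// -powRD ?subrK// cn0 implybT.
  have kE : (k * (c * l) = r * c `^ r * l)%R.
    by rewrite -ccE /k; ring.
  rewrite kE.
  case: (\int[l2]_(x in D2) (g x `^ r)) => [J| |].
  + by rewrite -EFinD !lee_fin => h; lra.
  + by move=> _; rewrite leey.
  + by [].
- case=> [M| |]//; last by move=> *; rewrite leey.
  rewrite lee_fin => M0 gM; rewrite lee_pdivrMr//.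
  rewrite -lE -integral_cst//.
  apply: ae_ge0_le_integral => //; first exact: mfD.
  by apply: filterS gM => x h _.
Qed.

End average.

(** * Chains of sets of finite measure *)

Record chain (R : realType) d (S : measurableType d)
    (l : {measure set S -> \bar R}) (I : Type) (A : I -> set S) : Prop := Chain {
  chain_measurable : forall i, measurable (A i) ;
  chain_total : forall i j, A i `<=` A j \/ A j `<=` A i ;
  chain_finite : forall i, l (A i) < +oo }.

Section chain_facts.
Context (R : realType) d (S : measurableType d) (l : {measure set S -> \bar R}).
Context (I : Type) (A : I -> set S) (cA : chain l A).

Let mA := chain_measurable cA.

Lemma chain_fin_num i : l (A i) \is a fin_num.
Proof. by rewrite ge0_fin_numE ?chain_finite. Qed.

(** If the inclusion goes the other way, the two measures coincide and are finite. Hence comparing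
    measures is as good as inclusion up to a null set, which lets a chain be handled through its
    measures alone. *)
Lemma chain_diff_null i j : l (A i) <= l (A j) -> l (A i `\` A j) = 0.
Proof.
move=> ij; have [AB|BA] := chain_total cA i j.
  by rewrite (_ : _ `\` _ = set0) ?measure0// -subset0 => x [/AB].
rewrite measureD//; last exact: chain_finite.
rewrite setIidr//; apply/eqP; rewrite sube_eq ?chain_fin_num//.
by rewrite add0e eq_le ij le_measure// inE.
Qed.

Lemma chain_diff_measure i j : l (A i) <= l (A j) ->
  l (A j `\` A i) = l (A j) - l (A i).
Proof.
move=> ij; rewrite measureD//; last exact: chain_finite.
have h : l (A i) = l (A i `&` A j).
  transitivity (l (A i `\` A j) + l (A i `&` A j)); first exact: measureDI.
  by rewrite chain_diff_null// add0e.
by congr (_ - _); rewrite setIC; exact: esym.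
Qed.

Lemma chain_integralD (g : S -> \bar R) i j : l (A i) <= l (A j) ->
  measurable_fun setT g -> (forall x, 0 <= g x) ->
  \int[l]_(x in A j) g x =
  \int[l]_(x in A i) g x + \int[l]_(x in A j `\` A i) g x.
Proof.
move=> ij mfg g0.
have mfD D : measurable_fun D g by exact: measurable_funTS.
have split_int k n : \int[l]_(x in A k) g x =
    \int[l]_(x in A k `&` A n) g x + \int[l]_(x in A k `\` A n) g x.
  rewrite -{1}(setUIDK (A k) (A n)) ge0_integral_setU//.
  - exact: measurableI.
  - exact: measurableD.
  - by apply/disj_setPS => x [[_ ?] []].
rewrite (split_int j i); congr (_ + _).
rewrite (split_int i j) setIC [X in _ + X](_ : _ = 0) ?adde0//.
by rewrite null_set_integral ?chain_diff_null//; exact: measurableD.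
Qed.

Lemma chain_integral_le (g : S -> \bar R) i j : l (A i) <= l (A j) ->
  measurable_fun setT g -> (forall x, 0 <= g x) ->
  \int[l]_(x in A i) g x <= \int[l]_(x in A j) g x.
Proof.
move=> ij mfg g0; rewrite (chain_integralD ij)// leeDl//.
exact: integral_ge0.
Qed.

(* Only the sets of smaller measure that exhaust the measure of [A j] are
   needed: a bounded truncation of [g] is absolutely continuous. *)
Lemma chain_integral_approx (g : S -> \bar R) j a :
  measurable_fun setT g -> (forall x, 0 <= g x) -> 0 <= a ->
  (forall e : R, (0 < e)%R -> exists i, [/\ l (A i) <= l (A j),
     l (A j) - e%:E <= l (A i) & \int[l]_(x in A i) g x <= a]) ->
  \int[l]_(x in A j) g x <= a.
Proof.
move=> mfg g0 a0 H.
pose t (n : nat) x := mine (g x) n%:R%:E.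
have mt n : measurable_fun setT (t n) by apply: measurable_mine.
have t0 n x : 0 <= t n x by rewrite le_min g0 lee_fin ler0n.
have ta n : \int[l]_(x in A j) t n x <= a.
  apply/lee_addgt0Pr => e e0.
  (* A truncation at height [n] over a set of measure at most e/(n+1) contributes at most [e]; the
     shift by one keeps the quotient meaningful at n = 0. *)
  have e'0 : (0 < e / n.+1%:R)%R by rewrite divr_gt0.
  have [i [ij ji gia]] := H _ e'0.
  rewrite (chain_integralD ij)//; apply: leeD.
    apply: le_trans gia; apply: ge0_le_integral => //.
    - exact: measurable_funTS.
    - exact: measurable_funTS.
    - by move=> x _; rewrite ge_min lexx.
  apply: (@le_trans _ _ (\int[l]_(x in A j `\` A i) cst n%:R%:E x)).
    apply: ge0_le_integral => //.
    - exact: measurableD.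
    - exact: measurable_funTS.
    - by move=> x _; rewrite /t ge_min lexx orbT.
  rewrite integral_cst; last exact: measurableD.
  rewrite chain_diff_measure//.
  have := ji; rewrite -(fineK (chain_fin_num i)) -(fineK (chain_fin_num j)).
  rewrite -!EFinB -EFinM !lee_fin => h.
  rewrite (@le_trans _ _ (n%:R * (e / n.+1%:R))%R)//.
    by rewrite ler_wpM2l// lerBlDr addrC -lerBlDr.
  by rewrite mulrC -mulrA ger_pMr// mulrC ler_pdivrMr// mul1r ler_nat.
have tg x : t n x @[n --> \oo] --> g x.
  have := g0 x; rewrite /t; case: (g x) => [s| |]// s0.
    apply: cvg_near_cst; near=> n; rewrite min_l// lee_fin.
    by near: n; exact: nbhs_infty_ger.
  rewrite (_ : (fun n : nat => mine +oo n%:R%:E) = (fun n : nat => n%:R%:E)).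
    by apply/cvgeryP; exact: cvgr_idn.
  by apply/funext => n; rewrite min_r// leey.
have -> : \int[l]_(x in A j) g x = \int[l]_(x in A j) limn (t ^~ x).
  by apply: eq_integral => x _; rewrite (cvg_lim _ (tg x)).
rewrite monotone_convergence//; last 2 first.
- by move=> n; exact: measurable_funTS.
- move=> x _ m n mn; rewrite /t le_min ge_min lexx/= ge_min lee_fin ler_nat mn.
  by rewrite orbT.
apply: lime_le; last exact: nearW.
apply: ereal_nondecreasing_is_cvgn => m n mn.
apply: ge0_le_integral => //; do ?exact: measurable_funTS.
move=> x _; rewrite /t le_min ge_min lexx/= ge_min lee_fin ler_nat mn.
by rewrite orbT.
Unshelve. all: by end_near. Qed.

End chain_facts.

Section interpolation.
Context (R : realType) d1 (S1 : measurableType d1) d2 (S2 : measurableType d2).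
Variables (l1 : {measure set S1 -> \bar R}) (l2 : {measure set S2 -> \bar R}).
Context (I : eqType) (A1 : I -> set S1) (A2 : I -> set S2).
Hypotheses (c1 : chain l1 A1) (c2 : chain l2 A2).
Hypothesis l12 : forall i, l1 (A1 i) = l2 (A2 i).

Let mA1 := chain_measurable c1.
Let mA2 := chain_measurable c2.

(* [h] averages [g] over the successive differences [A2 j `\` A2 i]; the norm
   does not increase by Jensen's inequality. *)
Lemma chain_interpolation (g : S2 -> \bar R) (i0 : I) (s : seq I) :
  measurable_fun setT g -> (forall x, 0 <= g x) ->
  A1 i0 = set0 -> A2 i0 = set0 ->
  path (fun i j => l1 (A1 i) <= l1 (A1 j)) i0 s ->
  exists h : S1 -> \bar R, [/\ measurable_fun setT h /\ forall x, 0 <= h x,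
    forall i, i \in i0 :: s -> l1 (A1 i) <= l1 (A1 (last i0 s)) /\
      \int[l1]_(x in A1 i) h x = \int[l2]_(x in A2 i) g x,
    forall r : R, (1 <= r)%R ->
      \int[l1]_x h x `^ r <= \int[l2]_(x in A2 (last i0 s)) g x `^ r
    & forall M, 0 <= M -> {ae l2, forall x, g x <= M} -> forall x, h x <= M].
Proof.
move=> mfg g0 A10 A20; elim/last_ind: s => [_|s j IH].
  exists (cst 0); split => //.
  - by move=> i; rewrite inE => /eqP ->/=; rewrite A10 A20 !integral_set0.
  - move=> r r1; rewrite A20 integral_set0 integral0_eq// => x _.
    by rewrite poweR0r// gt_eqF// (lt_le_trans _ r1).
rewrite rcons_path last_rcons; set k := last i0 s => /andP[/IH[h [[mfh h0] hI hr hM]] kj].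
pose D1 := A1 j `\` A1 k; pose D2 := A2 j `\` A2 k.
have mD1 : measurable D1 by exact: measurableD.
have mD2 : measurable D2 by exact: measurableD.
have kj2 : l2 (A2 k) <= l2 (A2 j) by rewrite -!l12.
have D12 : l1 D1 = l2 D2.
  rewrite /D1 /D2 (chain_diff_measure c1)// (chain_diff_measure c2)//.
  by rewrite !l12.
have D2oo : l2 D2 < +oo.
  apply: le_lt_trans (chain_finite c2 j).
  by apply: le_measure; rewrite ?inE// => x [].
have [c [c0 cI cr cM]] := average_step mD1 mD2 D12 D2oo mfg g0.
pose h' x := if x \in D1 then c else h x.
have h'E : h' = (h \_ (~` D1)) \+ (cst c \_ D1).
  apply/funext => x; rewrite /h' !patchE in_setC.
  by case: ifPn => _ /=; rewrite ?add0e ?adde0.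
have mfh' : measurable_fun setT h'.
  rewrite h'E; apply: emeasurable_funD.
  - apply/(measurable_restrictT _ (measurableC mD1)); exact: measurable_funTS.
  - by apply/(measurable_restrictT _ mD1); exact: measurable_cst.
have h'0 x : 0 <= h' x by rewrite /h'; case: ifPn.
have h'D1 : \int[l1]_(x in D1) h' x = \int[l2]_(x in D2) g x.
  rewrite -cI -integral_cst//; apply: eq_integral => x xD1.
  by rewrite /h' xD1.
(* On the earlier sets [h'] differs from [h] only inside [A1 i] minus [A1 k], a null set, so the
   integrals already matched are kept. *)
have h'h i : l1 (A1 i) <= l1 (A1 k) ->
    \int[l1]_(x in A1 i) h' x = \int[l1]_(x in A1 i) h x.
  move=> ik; apply: ge0_ae_eq_integral => //; do ?exact: measurable_funTS.
  exists (A1 i `\` A1 k); split; first exact: measurableD.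
    exact: chain_diff_null ik.
  move=> x /=; rewrite /h' => /not_implyP[Aix]; case: ifPn => //.
  by rewrite inE => -[_ ?].
exists h'; split => //.
- move=> i; rewrite -rcons_cons mem_rcons inE => /predU1P[->|/hI[ik hi]].
    split => //; rewrite (chain_integralD c1 kj)// (chain_integralD c2 kj2)//.
    rewrite -/D1 -/D2 h'D1 h'h//.
    by have [_ ->] := hI k (mem_last _ _).
  by split; [exact: le_trans kj|rewrite h'h].
- move=> r r1.
  have mgr : measurable_fun setT (fun x => g x `^ r).
    exact: measurable_poweR_comp.
  rewrite (chain_integralD c2 kj2) => [|//|x]; last exact: poweR_ge0.
  have mhr := measurable_poweR_comp r mfh.
  (* It suffices that h'^r is at most h^r plus c^r on [D1]; this way nothing has to be known about
     [h] on [D1]. *)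
  apply: (@le_trans _ _ (\int[l1]_x (h x `^ r + (cst (c `^ r) \_ D1) x))).
    apply: ge0_le_integral => //.
    - by move=> x _; exact: poweR_ge0.
    - exact: measurable_poweR_comp.
    - apply: emeasurable_funD => //; apply/(measurable_restrictT _ mD1).
      exact: measurable_cst.
    - move=> x _; rewrite /h' patchE; case: ifPn => _; last by rewrite adde0.
      by rewrite leeDr// poweR_ge0.
  have hr0 x : setT x -> 0 <= h x `^ r by move=> _; exact: poweR_ge0.
  rewrite ge0_integralD//; last 2 first.
  - by move=> x _; rewrite patchE; case: ifPn => // _; exact: poweR_ge0.
  - by apply/(measurable_restrictT _ mD1); exact: measurable_cst.
  rewrite -integral_mkcond integral_cst//.
  by apply: leeD; [exact: hr|exact: cr].
- move=> M M0 gM x; rewrite /h'; case: ifPn => _; [exact: cM|exact: hM].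
Qed.

End interpolation.

(* Besides rational brackets of [v y], the indices [inr a] are needed for the
   values of [v] that are isolated from below. *)
Lemma dense_from_below (R : realType) (Y : pointedType) (v : Y -> R) :
  exists z : nat -> Y, forall y (e : R), (0 < e)%R ->
    exists n, (v (z n) <= v y)%R /\ (v y - e < v (z n))%R.
Proof.
pose T := (rat * rat + rat)%type.
pose P (t : T) y := match t with
  | inl (a, b) => (ratr a <= v y)%R /\ (v y <= ratr b)%R
  | inr a => (ratr a <= v y)%R /\ forall y', (ratr a <= v y')%R -> (v y <= v y')%R
  end.
have [w wP] : {w : T -> Y & forall t, (exists y, P t y) -> P t (w t)}.
  exists (fun t => if pselect (exists y, P t y) is left h
                   then projT1 (cid h) else point).
  by move=> t ht; case: pselect => // h; case: cid.
exists (fun n => if unpickle n is Some t then w t else point) => y e e0.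
have yey : (v y - e < v y)%R by rewrite ltrBlDr ltrDl.
have [a] := rat_in_itvoo yey; rewrite in_itv/= => /andP[ea ay].
suff [t [ty yt]] : exists t, (v (w t) <= v y)%R /\ (v y - e < v (w t))%R.
  by exists (pickle t); rewrite pickleK.
(* If some value of [v] lies in [a, v y), a rational [b] above it and below [v y] closes a non-empty
   bracket. Otherwise [v y] is the least value from [a] on, and [inr a] selects a point with that
   value. *)
have [[y' [ay' y'y]]|noy'] := pselect (exists y', (ratr a <= v y')%R /\ (v y' < v y)%R).
  have [b] := rat_in_itvoo y'y; rewrite in_itv/= => /andP[y'b by_].
  have [h1 h2] : P (inl (a, b)) (w (inl (a, b))).
    by apply: wP; exists y'; split => //; exact: ltW.
  exists (inl (a, b)); split; first exact/ltW/(le_lt_trans h2).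
  exact: lt_le_trans h1.
have [h1 h2] : P (inr a) (w (inr a)).
  apply: wP; exists y; split => /=; first exact: ltW.
  move=> y' ay'; rewrite leNgt; apply/negP => y'y.
  by apply: noy'; exists y'.
exists (inr a); split; first exact/h2/ltW.
exact: lt_le_trans h1.
Qed.

(** * Approximation of the Hardy operator by finite maxima *)

Section hardy_approximation.
Context (R : realType) d (S : measurableType d) (l : {measure set S -> \bar R}).
Context dY (Y : measurableType dY) (A : Y -> set S).
Hypotheses (cA : chain l A) (mlA : measurable_fun setT (fun y => l (A y))).

(** An approximation from below that involves finitely many sets and depends on [y] only through
    [l (A y)]. The first property makes [chain_interpolation] applicable, the second makes
    measurability in [y] evident. *)
Fixpoint hardy_max (z : nat -> Y) (g : S -> \bar R) (N : nat) (y : Y) : \bar R :=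
  if N is n.+1 then
    maxe (hardy_max z g n y)
         (if l (A (z n)) <= l (A y) then \int[l]_(x in A (z n)) g x else 0)
  else 0.

Lemma hardy_max_leP z g N y a : 0 <= a ->
  (forall i : nat, (i < N)%N -> l (A (z i)) <= l (A y) ->
    \int[l]_(x in A (z i)) g x <= a) -> hardy_max z g N y <= a.
Proof.
move=> a0; elim: N => [//|N IH] H /=; rewrite ge_max IH => [|i iN]; last first.
  by apply: H; rewrite ltnS ltnW.
by case: ifPn => // h; exact: H.
Qed.

Lemma nondecreasing_hardy_max z g y : nondecreasing_seq (hardy_max z g ^~ y).
Proof. by apply/nondecreasing_seqP => n /=; rewrite le_max lexx. Qed.

Lemma hardy_max_ge0 z g N y : 0 <= hardy_max z g N y.
Proof. exact: (@nondecreasing_hardy_max z g y 0%N). Qed.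

Lemma measurable_hardy_max z g N : measurable_fun setT (hardy_max z g N).
Proof.
elim: N => [|N IH] /=; first exact: measurable_cst.
apply: measurable_maxe => //; apply: measurable_fun_ifT => //.
exact: measurable_fun_lee.
Qed.

(** The points [z] are chosen from the measures alone, so one sequence serves every [g]. Their
    measures approach each [l (A y)] from below, which is the situation of [chain_integral_approx]
    with the supremum as bound. *)
Lemma hardy_max_cvg : exists z : nat -> Y, forall g : S -> \bar R,
  measurable_fun setT g -> (forall x, 0 <= g x) ->
  forall y, hardy_max z g n y @[n --> \oo] --> hardy_operator l A g y.
Proof.
have [z zP] := dense_from_below (fun y => fine (l (A y))).
exists z => g mfg g0 y.
have := ereal_nondecreasing_cvgn (@nondecreasing_hardy_max z g y).
set s := ereal_sup _; suff -> : s = hardy_operator l A g y by [].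
apply/eqP; rewrite eq_le; apply/andP; split.
  apply: ge_ereal_sup => _ [n _ <-]; apply: hardy_max_leP.
    exact: integral_ge0.
  by move=> i _ iy; exact: chain_integral_le.
have s_ge n : hardy_max z g n y <= s by apply: ereal_sup_ubound; exists n.
apply: (chain_integral_approx cA) => //.
  exact: le_trans (hardy_max_ge0 z g 0 y) _.
move=> e e0; have [n [ny yn]] := zP y e e0.
have ny' : l (A (z n)) <= l (A y).
  by rewrite -(fineK (chain_fin_num cA (z n))) -(fineK (chain_fin_num cA y)) lee_fin.
exists (z n); split => //.
  rewrite -(fineK (chain_fin_num cA (z n))) -(fineK (chain_fin_num cA y)).
  by rewrite -EFinB lee_fin ltW.
apply: le_trans (s_ge n.+1); rewrite /= ny' le_max lexx.
by rewrite orbT.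
Qed.

Lemma measurable_hardy g : measurable_fun setT g -> (forall x, 0 <= g x) ->
  measurable_fun setT (hardy_operator l A g).
Proof.
move=> mfg g0; have [z zP] := hardy_max_cvg.
apply: emeasurable_fun_cvg => [n|y _]; last exact: zP.
exact: measurable_hardy_max.
Qed.

Lemma hardy_ge0 g y : (forall x, 0 <= g x) -> 0 <= hardy_operator l A g y.
Proof. by move=> g0; exact: integral_ge0. Qed.

End hardy_approximation.

(** The added empty set is the bottom element from which [chain_interpolation] starts. *)
Lemma chain_option (R : realType) d (S : measurableType d)
    (l : {measure set S -> \bar R}) (I : Type) (A : I -> set S) :
  chain l A -> chain l (fun o => if o is Some i then A i else set0).
Proof.
move=> cA; split => [[i|]//|[i|] [j|]|[i|]] /=; rewrite ?measure0//.
- exact: (chain_measurable cA).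
- exact: (chain_total cA).
- by right.
- by left.
- by left.
- exact: (chain_finite cA).
Qed.

(* By [hardy_max_cvg] it is enough to treat finitely many sets of the chain, to
   which [chain_interpolation] applies. *)
Lemma chain_transfer (R : realType)
    d1 (S1 : measurableType d1) d2 (S2 : measurableType d2)
    (l1 : {measure set S1 -> \bar R}) (l2 : {measure set S2 -> \bar R})
    dY (Y : measurableType dY) (mu : {measure set Y -> \bar R})
    (A1 : Y -> set S1) (A2 : Y -> set S2) (p q c : \bar R) (g : S2 -> \bar R) :
  chain l1 A1 -> chain l2 A2 -> (forall y, l1 (A1 y) = l2 (A2 y)) ->
  measurable_fun setT (fun y => l1 (A1 y)) ->
  1 <= p -> 0 < q -> 0 <= c ->
  measurable_fun setT g -> (forall x, 0 <= g x) ->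
  (forall h : S1 -> \bar R, measurable_fun setT h -> (forall x, 0 <= h x) ->
     Lnorm l1 p h <= Lnorm l2 p g ->
     Lnorm mu q (hardy_operator l1 A1 h) <= c) ->
  Lnorm mu q (hardy_operator l2 A2 g) <= c.
Proof.
move=> c1 c2 l12 ml1 p1 q0 c0 mfg g0 H.
have ml2 : measurable_fun setT (fun y => l2 (A2 y)).
  by under eq_fun do rewrite -l12.
have [z zP] := hardy_max_cvg c2.
apply: (@le_Lnorm_sup _ _ _ mu (hardy_max l2 A2 z g)) => //.
- by move=> n; exact: measurable_hardy_max.
- by move=> n y; exact: hardy_max_ge0.
- by move=> y; exact: nondecreasing_hardy_max.
- by move=> y; exact: zP.
move=> N.
pose A1' (o : option Y) := if o is Some y then A1 y else set0.
pose A2' (o : option Y) := if o is Some y then A2 y else set0.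
have c1' : chain l1 A1' by exact: chain_option.
have c2' : chain l2 A2' by exact: chain_option.
have l12' o : l1 (A1' o) = l2 (A2' o) by case: o => [y|] /=; rewrite ?measure0.
pose le1 (i j : option Y) := l1 (A1' i) <= l1 (A1' j).
(* Sorting the sampled sets by measure turns them into the path that [chain_interpolation]
   expects. *)
pose s := sort le1 [seq Some (z i) | i <- iota 0 N].
have ps : path le1 None s.
  rewrite path_sortedE; last by move=> i j k; exact: le_trans.
  rewrite sort_sorted ?andbT; last by move=> i j; exact: le_total.
  by apply/allP => i _; rewrite /le1 /= measure0.
have [h [[mfh h0] hI hr hM]] :=
  chain_interpolation c1' c2' l12' mfg g0 (erefl : A1' None = set0) erefl ps.
have hp : Lnorm l1 p h <= Lnorm l2 p g.
  case: p p1 {H} => [r| |]//.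
    rewrite lee_fin => r1; have r0 : (0 < r)%R by rewrite (lt_le_trans ltr01).
    rewrite Lnorm_leP ?Lnorm_ge0// poweR_Lnorm ?gt_eqF//.
    under eq_integral do rewrite gee0_abs//.
    apply: le_trans (hr _ r1) _.
    under [leRHS]eq_integral do rewrite gee0_abs//.
    apply: ge0_subset_integral => //.
    - exact: chain_measurable c2' _.
    - exact: measurable_poweR_comp.
    - by move=> *; exact: poweR_ge0.
  move=> _; apply: Lnormy_le; first exact: Lnorm_ge0.
  apply: aeW => x; rewrite gee0_abs//; apply: hM; first exact: Lnorm_ge0.
  by apply: filterS (ae_abse_le_Lnormy l2 mfg) => t; rewrite gee0_abs.
apply: le_trans (H h mfh h0 hp).
(* On the sampled sets the integrals of [h] and [g] agree, so by monotonicity along the first chain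
   the finite maximum for [g] is dominated by the Hardy operator applied to [h]. *)
apply: le_Lnorm => //; first exact: measurable_hardy_max.
  exact: measurable_hardy.
move=> y; rewrite gee0_abs ?hardy_max_ge0// gee0_abs ?hardy_ge0//.
apply: hardy_max_leP; first exact: hardy_ge0.
move=> i iN iy; have /hI[_ <-] : Some (z i) \in None :: s.
  rewrite inE/= mem_sort; apply: map_f.
  by rewrite mem_iota.
by apply: (chain_integral_le c1) => //; rewrite !l12.
Qed.

(** * Rearrangement *)

Definition pos_itv (R : realType) (c : \bar R) : set R :=
  [set t | (0 < t)%R /\ t%:E < c].

Section pos_itv_facts.
Context (R : realType).
Implicit Types (c : \bar R) (f : R -> \bar R).

Lemma measurable_pos_itv c : measurable (pos_itv c : set (measurableTypeR R)).
Proof.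
rewrite (_ : pos_itv c = `]0%R, +oo[ `&` [set t : measurableTypeR R | t%:E < c]).
  apply: measurableI => //; rewrite -[X in measurable X]setTI.
  exact: emeasurable_fun_infty_o.
by apply/seteqP; split => t /=; rewrite in_itv/= andbT.
Qed.

Lemma pos_itvS c c' : c <= c' -> pos_itv c `<=` pos_itv c'.
Proof. by move=> cc' t [t0 tc]; split => //; exact: lt_le_trans cc'. Qed.

Lemma lebesgue_pos_pos_itv c : 0 <= c -> lebesgue_pos R (pos_itv c) = c.
Proof.
move=> c0; rewrite lebesgue_posE setIidl; first exact: lebesgue_measure_oo.
by move=> t [t0 _] /=; rewrite in_itv/= t0.
Qed.

Definition primitive f c : \bar R := \int[lebesgue_pos R]_(t in pos_itv c) f t.

(** Writing H_b f as a function of b alone is what makes equimeasurability applicable. The value 0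
    at x <= 0 is that of the primitive at 0. *)
Lemma normal_form_operatorE (b : R -> \bar R) f x :
  normal_form_operator b f x = primitive f (if (0 < x)%R then b x else 0).
Proof.
rewrite /normal_form_operator /primitive; case: ifPn => _; last first.
  rewrite (_ : pos_itv 0 = set0) ?integral_set0//.
  by apply/seteqP; split => t // [t0]; rewrite lte_fin ltNge ltW.
apply: eq_measure_integral => D _ Dsub; rewrite lebesgue_posE setIidl//.
by move=> t /Dsub [t0 _] /=; rewrite in_itv/= t0.
Qed.

Variable f : R -> \bar R.
Hypotheses (mfun_f : measurable_fun setT (f : measurableTypeR R -> \bar R))
  (f0 : forall x, 0 <= f x).

Lemma primitive_ge0 c : 0 <= primitive f c.
Proof. exact: integral_ge0. Qed.

Lemma primitive0 : primitive f 0 = 0.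
Proof.
rewrite /primitive (_ : pos_itv 0 = set0) ?integral_set0//.
by apply/seteqP; split => t // [t0]; rewrite lte_fin ltNge ltW.
Qed.

Lemma le_primitive c c' : c <= c' -> primitive f c <= primitive f c'.
Proof.
move=> cc'; apply: ge0_subset_integral; [exact: measurable_pos_itv..| | |].
- exact: measurable_funTS.
- by [].
- exact: pos_itvS.
Qed.

(** The interval (0, c) is the increasing union of intervals (0, v n) with v n < c, also for c =
    +oo, so the integrals over them converge to the integral over (0, c). *)
Lemma primitive_left_continuous (s : \bar R) c : 0 <= s -> 0 <= c ->
  s < primitive f c ->
  exists c' : R, [/\ (0 <= c')%R, c'%:E < c & s < primitive f c'%:E].
Proof.
move=> s0 c0 sF.
have cgt0 : 0 < c.
  rewrite lt0e c0 andbT; apply: contraTN sF => /eqP ->.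
  by rewrite primitive0 -leNgt.
have [v [ndv vc cv]] : exists v : nat -> R, [/\ nondecreasing_seq v,
    forall n, (v n)%:E < c & forall t : R, t%:E < c -> exists n, (t < v n)%R].
  case: c cgt0 {c0 sF} => [c| |]// cgt0.
    exists (fun n => c - n.+1%:R^-1)%R; split.
    - by move=> m n mn; rewrite lerD2l lerN2 lef_pV2 ?posrE// ler_nat.
    - by move=> n; rewrite lte_fin ltrBlDr ltrDl.
    - move=> t; rewrite lte_fin -subr_gt0 => tc.
      have [n nP] := ltr_add_invr (tc : (0 < c - t)%R).
      by exists n; move: nP; rewrite add0r ltrBrDr addrC -ltrBrDr.
  exists (fun n => n%:R); split => //.
  - by move=> m n mn; rewrite ler_nat.
  - by move=> n; rewrite ltry.
  - by move=> t _; exists (Num.truncn t).+1; rewrite Num.Theory.truncnS_gt.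
have cvF : primitive f (v n)%:E @[n --> \oo] --> primitive f c.
  rewrite {2}/primitive (_ : pos_itv c = \bigcup_n pos_itv (v n)%:E); last first.
    apply/seteqP; split => [t [t0 /cv[n tn]]|t [n _ [t0 tn]]]; first by exists n.
    by split => //; exact: lt_trans (vc n).
  apply: ge0_nondecreasing_set_cvg_integral.
  - by move=> m n mn; apply/subsetPset/pos_itvS; rewrite lee_fin ndv.
  - by move=> n; exact: measurable_pos_itv.
  - by move=> n; exact: measurable_funTS.
  - by [].
have [n sn] : exists n, s < primitive f (v n)%:E.
  apply: contrapT => /forallNP H; move: sF; apply/negP; rewrite -leNgt.
  rewrite -(cvg_lim _ cvF)//; apply: lime_le; first exact: (cvgP _ cvF).
  by apply: nearW => n; rewrite leNgt; exact/negP.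
exists (v n); split => //; rewrite leNgt; apply/negP => vn0.
move: sn; apply/negP; rewrite -leNgt; apply: le_trans s0.
by rewrite -primitive0; apply: le_primitive; rewrite lee_fin ltW.
Qed.

End pos_itv_facts.

(* For [G] with non-negative values: [G] is non-decreasing and left-continuous
   on [[0, +oo]], and vanishes at [0]. *)
Definition ray_like (R : realType) (G : \bar R -> \bar R) : Prop :=
  forall s : R, (0 <= s)%R -> (forall c, 0 <= c -> G c <= s%:E) \/
    exists2 t : R, (0 <= t)%R & forall c, 0 <= c -> (s%:E < G c) = (t%:E < c).

(** The threshold is the supremum of the points where the primitive is at most [s]; left-continuity
    keeps the threshold itself on that side. If these points are unbounded, the primitive never
    exceeds [s]. *)
Lemma primitive_ray_like (R : realType) (f : R -> \bar R) :
  measurable_fun setT (f : measurableTypeR R -> \bar R) ->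
  (forall x, 0 <= f x) -> ray_like (primitive f).
Proof.
move=> mfun_f f0 s s0.
pose Z := [set t : R | (0 <= t)%R /\ primitive f t%:E <= s%:E].
have Z0 : Z 0%R by split => //; rewrite primitive0.
have lZ (c : R) : s%:E < primitive f c%:E -> ubound Z c.
  move=> sc t [t0 ts]; rewrite leNgt; apply/negP => ct.
  have := lt_le_trans sc (le_primitive mfun_f f0 (ltW ct : c%:E <= t%:E)).
  by rewrite ltNge ts.
have [ubZ|nubZ] := pselect (has_ubound Z); last first.
  left => c c0; rewrite leNgt; apply/negP => sc.
  have [c' [_ _ sc']] := @primitive_left_continuous R f mfun_f f0 s%:E c s0 c0 sc.
  by apply: nubZ; exists c'; exact: lZ.
right; exists (sup Z); first exact: ub_le_sup.
move=> c c0; apply/idP/idP => [sc|].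
  have [c' [_ c'c sc']] := @primitive_left_continuous R f mfun_f f0 s%:E c s0 c0 sc.
  apply: le_lt_trans c'c; rewrite lee_fin; apply: ge_sup; first by exists 0%R.
  exact: lZ.
have H (r : R) : (sup Z < r)%R -> s%:E < primitive f r%:E.
  move=> Zr; rewrite ltNge; apply/negP => rs.
  have : Z r by split => //; rewrite (le_trans _ (ltW Zr))//; exact: ub_le_sup.
  by move=> /(ub_le_sup ubZ); rewrite leNgt Zr.
case: c c0 => [c| |]// _; first by rewrite lte_fin; exact: H.
move=> _; apply: (@lt_le_trans _ _ (primitive f (sup Z + 1)%:E)).
  by apply: H; rewrite ltrDl.
by apply: le_primitive => //; rewrite leey.
Qed.

Lemma measurable_superlevelP d (T : measurableType d) (R : realType)
    (u : T -> \bar R) : (forall x, 0 <= u x) ->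
  (forall s : R, (0 <= s)%R -> measurable [set x | s%:E < u x]) ->
  measurable_fun setT u.
Proof.
move=> u0 H; apply: (measurability _ (ErealGenOInfty.measurableE R)) => //.
move=> _ [_ [s ->] <-]; rewrite setTI.
have [s0|s0] := leP 0%R s.
  rewrite (_ : _ @^-1` _ = [set x | s%:E < u x]); first exact: H.
  by apply/seteqP; split => x /=; rewrite in_itv/= andbT.
rewrite (_ : _ @^-1` _ = setT)//; apply/seteqP; split => x //= _.
by rewrite in_itv/= andbT (lt_le_trans _ (u0 x)).
Qed.

(** * Monotone functions of equimeasurable functions *)

Section equimeasurable.
Context (R : realType) d1 (T1 : measurableType d1) d2 (T2 : measurableType d2).
Variables (m1 : {measure set T1 -> \bar R}) (m2 : {measure set T2 -> \bar R}).
Hypotheses (sf1 : sigma_finite setT m1) (sf2 : sigma_finite setT m2).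
Variables (v1 : T1 -> \bar R) (v2 : T2 -> \bar R).
Hypotheses (mv1 : measurable_fun setT v1) (mv2 : measurable_fun setT v2).
Hypotheses (v10 : forall x, 0 <= v1 x) (v20 : forall x, 0 <= v2 x).
Hypothesis v12 : forall t : R, (0 <= t)%R ->
  m1 [set x | t%:E < v1 x] = m2 [set x | t%:E < v2 x].
Variable G : \bar R -> \bar R.
Hypotheses (G0 : forall c, 0 <= G c) (Gr : ray_like G).

Lemma measurable_ray_like d (T : measurableType d) (v : T -> \bar R) :
  measurable_fun setT v -> (forall x, 0 <= v x) ->
  measurable_fun setT (G \o v).
Proof.
move=> mv v0; apply: measurable_superlevelP => [x|s s0]; first exact: G0.
have [H|[t t0 H]] := Gr s0.
  rewrite (_ : [set _ | _] = set0)//; apply/seteqP; split => x //=.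
  by rewrite ltNge H.
rewrite (_ : [set _ | _] = [set x | t%:E < v x]); first exact: measurable_superlevel.
by apply/seteqP; split => x /=; rewrite H.
Qed.

(** At each height, the superlevel set of [G \o v] is either empty or a superlevel set of [v], and
    both the case and the level depend on [G] only. *)
Lemma equimeasurable_Lnorm q : 0 < q -> Lnorm m1 q (G \o v1) = Lnorm m2 q (G \o v2).
Proof.
move=> q0; apply: eq_distribution_Lnorm => //; do ?exact: measurable_ray_like.
- by move=> x /=.
- by move=> x /=.
move=> s s0; have [H|[t t0 H]] := Gr s0.
  have Z d (T : measurableType d) (v : T -> \bar R) : (forall x, 0 <= v x) ->
      [set x | s%:E < (G \o v) x] = set0.
    by move=> v0; apply/seteqP; split => x //=; rewrite ltNge H.
  by rewrite !Z// !measure0.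
transitivity (m1 [set x | t%:E < v1 x]).
  by congr (m1 _); apply/seteqP; split => x /=; rewrite H.
by rewrite v12//; congr (m2 _); apply/seteqP; split => x /=; rewrite H.
Qed.

Lemma measurable_middle d (T : measurableType d) (v : T -> \bar R) a c :
  measurable_fun setT v -> measurable [set x | a < v x /\ v x <= c].
Proof.
move=> mv; apply: measurableI; first exact: measurable_superlevel.
by rewrite -[X in measurable X]setTI; exact: emeasurable_fun_infty_c.
Qed.

Hypothesis fin1 : forall t : R, (0 < t)%R -> m1 [set x | t%:E < v1 x] < +oo.

(** After restriction the superlevel sets are differences of superlevel sets of [v], the larger one
    at level [w >= a > 0]. By [fin1] its measure is finite, so the measures can be subtracted. *)
Lemma equimeasurable_middle (q a c : R) : (0 < q)%R -> (0 < a)%R ->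
  \int[m1]_(x in [set x | a%:E < v1 x /\ v1 x <= c%:E]) G (v1 x) `^ q =
  \int[m2]_(x in [set x | a%:E < v2 x /\ v2 x <= c%:E]) G (v2 x) `^ q.
Proof.
move=> q0 a0.
have E d (T : measurableType d) (m : {measure set T -> \bar R}) (v : T -> \bar R) :
  \int[m]_(x in [set x | a%:E < v x /\ v x <= c%:E]) G (v x) `^ q =
  Lnorm m q%:E ((G \o v) \_ [set x | a%:E < v x /\ v x <= c%:E]) `^ q.
  rewrite poweR_Lnorm ?gt_eqF// integral_mkcond; apply: eq_integral => x _.
  rewrite !patchE; case: ifPn => _ /=; first by rewrite gee0_abs.
  by rewrite normr0 powR0// gt_eqF.
rewrite !E; congr (_ `^ _).
have M d (T : measurableType d) (v : T -> \bar R) : measurable_fun setT v ->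
    (forall x, 0 <= v x) ->
    measurable_fun setT ((G \o v) \_ [set x | a%:E < v x /\ v x <= c%:E]).
  move=> mv v0; apply/(measurable_restrictT _ (measurable_middle _ _ mv)).
  exact/measurable_funTS/measurable_ray_like.
have P0 d (T : measurableType d) (v : T -> \bar R) x :
    0 <= ((G \o v) \_ [set x | a%:E < v x /\ v x <= c%:E]) x.
  by rewrite patchE; case: ifPn => //=.
apply: eq_distribution_Lnorm => //; do ?exact: M.
move=> s s0; have [H|[t t0 H]] := Gr s0.
  have Z d (T : measurableType d) (v : T -> \bar R) : (forall x, 0 <= v x) ->
      [set x | s%:E < ((G \o v) \_ [set x | a%:E < v x /\ v x <= c%:E]) x] = set0.
    move=> v0; apply/seteqP; split => x //=; rewrite patchE ltNge.
    by case: ifPn => _ /=; rewrite ?H// lee_fin s0.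
  by rewrite !Z// !measure0.
pose w := Num.max t a.
have D d (T : measurableType d) (v : T -> \bar R) : (forall x, 0 <= v x) ->
    [set x | s%:E < ((G \o v) \_ [set x | a%:E < v x /\ v x <= c%:E]) x] =
    [set x | w%:E < v x] `\` [set x | c%:E < v x].
  move=> v0; apply/seteqP; split => x /=; rewrite patchE.
    case: ifPn; last by rewrite lte_fin ltNge s0.
    rewrite inE/= => -[ax xc]; rewrite H// => tx; split; last by apply/negP; rewrite -leNgt.
    by rewrite /w; have [ta|ta] := leP t a.
  move=> [wx /negP]; rewrite -leNgt => xc.
  have ax : a%:E < v x by apply: le_lt_trans wx; rewrite lee_fin le_max lexx orbT.
  have tx : t%:E < v x by apply: le_lt_trans wx; rewrite lee_fin le_max lexx.
  by rewrite mem_set//= H.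
have w0 : (0 < w)%R by rewrite lt_max a0 orbT.
clearbody w.
have I d (T : measurableType d) (v : T -> \bar R) :
    [set x | w%:E < v x] `&` [set x | c%:E < v x] = [set x | (Num.max w c)%:E < v x].
  apply/seteqP; split => x /=; rewrite EFin_max gt_max; first by move=> [-> ->].
  by move=> /andP[].
have W0 : (0 <= Num.max w c)%R by rewrite le_max (ltW w0).
rewrite !D// measureD; [|exact: measurable_superlevel..|exact: fin1].
have w2 : m2 [set x | w%:E < v2 x] < +oo by rewrite -v12 ?fin1// ltW.
rewrite measureD; [|exact: measurable_superlevel..|exact: w2].
by congr (_ - _); rewrite ?I; [apply/v12/ltW|exact: v12].
Qed.

(** The argument for the middle fails here, since the part of the tail where [v] is small and
    positive may have infinite measure. Instead the equal middle parts are subtracted from the equal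
    and finite total integrals. *)
Lemma equimeasurable_tail (q a c : R) : (0 < q)%R -> (0 < a)%R ->
  \int[m1]_x G (v1 x) `^ q < +oo ->
  \int[m1]_(x in ~` [set x | a%:E < v1 x /\ v1 x <= c%:E]) G (v1 x) `^ q =
  \int[m2]_(x in ~` [set x | a%:E < v2 x /\ v2 x <= c%:E]) G (v2 x) `^ q.
Proof.
move=> q0 a0 I1oo.
have split_int d (T : measurableType d) (m : {measure set T -> \bar R}) (v : T -> \bar R) :
    measurable_fun setT v -> (forall x, 0 <= v x) ->
  \int[m]_x G (v x) `^ q =
  \int[m]_(x in ~` [set x | a%:E < v x /\ v x <= c%:E]) G (v x) `^ q +
  \int[m]_(x in [set x | a%:E < v x /\ v x <= c%:E]) G (v x) `^ q.
  move=> mv v0; have mm := measurable_middle a%:E c%:E mv.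
  rewrite -[in LHS](setvU [set x | a%:E < v x /\ v x <= c%:E]).
  rewrite ge0_integral_setU//.
  - exact: measurableC.
  - by apply/measurable_funTS/(measurable_poweR_comp q); exact: measurable_ray_like.
  - by move=> *; exact: poweR_ge0.
  - by apply/disj_setPS => x [].
have I12 : \int[m1]_x G (v1 x) `^ q = \int[m2]_x G (v2 x) `^ q.
  transitivity (Lnorm m1 q%:E (G \o v1) `^ q).
    rewrite poweR_Lnorm ?gt_eqF//.
    by under [RHS]eq_integral do rewrite gee0_abs//=.
  rewrite equimeasurable_Lnorm// poweR_Lnorm ?gt_eqF//.
  by under eq_integral do rewrite gee0_abs//=.
have := I12; rewrite (split_int _ _ m1)// (split_int _ _ m2)// equimeasurable_middle//.
set t1 := integral _ (~` _) _; set t2 := integral _ (~` _) _; set mid := integral _ _ _.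
have midoo : mid \is a fin_num.
  have mid0 : 0 <= mid by apply: integral_ge0 => *; exact: poweR_ge0.
  rewrite ge0_fin_numE//; apply: le_lt_trans I1oo; rewrite I12 (split_int _ _ m2)//.
  by rewrite -/mid leeDr//; apply: integral_ge0 => *; exact: poweR_ge0.
by move=> /(congr1 (fun z => z - mid)); rewrite !addeK.
Qed.

End equimeasurable.

Section rearrangement_facts.
Context (R : realType) d (Y : measurableType d) (mu : {measure set Y -> \bar R}).
Variable u : Y -> \bar R.
Hypotheses (mfu : measurable_fun setT u) (u0 : forall y, 0 <= u y).

Let distrE t : distribution_function mu u t = mu [set y | t%:E < u y].
Proof.
by congr (mu _); apply/seteqP; split => y /=; rewrite gee0_abs.
Qed.

(** The implication from right to left rests on right-continuity of the distribution function: if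
    [x] lies below it at [t], then also at some slightly larger level, and the supremum exceeds [t]
    strictly. *)
Lemma rearrangement_gt (x t : R) : (0 <= t)%R ->
  (t%:E < rearrangement mu u x) = (x%:E < mu [set y | t%:E < u y]).
Proof.
move=> t0; apply/idP/idP.
  move=> /ereal_sup_gt[_ /= [->|[s [s0 xs] <-]]].
    by rewrite lte_fin ltNge t0.
  rewrite lte_fin => ts; apply: lt_le_trans xs _; rewrite distrE.
  apply: le_measure; rewrite ?inE; do ?exact: measurable_superlevel.
  by move=> y /=; apply: lt_trans; rewrite lte_fin.
move=> xt.
pose F (n : nat) := [set y | (t + n.+1%:R^-1)%:E < u y].
have mF n : measurable (F n) by exact: measurable_superlevel.
have UF : [set y | t%:E < u y] = \bigcup_n F n.
  apply/seteqP; split => [y /= ty|y [n _]]; last first.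
    by apply: lt_trans; rewrite lte_fin ltrDl.
  case uy: (u y) ty => [s| |]// ty.
    have [n nP] := ltr_add_invr (ty : (t < s)%R).
    by exists n => //; rewrite /F/= uy lte_fin.
  by exists 0%N => //; rewrite /F/= uy ltry.
have cF : mu (F n) @[n --> \oo] --> mu [set y | t%:E < u y].
  rewrite UF; apply: nondecreasing_cvg_mu => //; first exact: bigcupT_measurable.
  move=> m n mn; apply/subsetPset => y /=; apply: le_lt_trans.
  by rewrite lee_fin lerD2l lef_pV2 ?posrE// ler_nat.
have [n xn] : exists n, x%:E < mu (F n).
  apply: contrapT => /forallNP H; move: xt; apply/negP; rewrite -leNgt.
  rewrite -(cvg_lim _ cF)//; apply: lime_le; first exact: (cvgP _ cF).
  by apply: nearW => n; rewrite leNgt; exact/negP.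
apply: (@lt_le_trans _ _ (t + n.+1%:R^-1)%:E); first by rewrite lte_fin ltrDl.
apply: ereal_sup_ubound; right; exists (t + n.+1%:R^-1)%R => //.
by split; [rewrite ltr_wpDl|rewrite distrE].
Qed.

Lemma rearrangement_ge0 x : 0 <= rearrangement mu u x.
Proof. by apply: ereal_sup_ubound; left. Qed.

Lemma normal_form_parameter_rearrangement :
  normal_form_parameter (rearrangement mu u).
Proof.
split => [x _|x y _ xy]; first exact: rearrangement_ge0.
apply: le_ereal_sup => _ [->|[t [t0 yt] <-]]; first by left.
by right; exists t => //; split => //; apply: le_lt_trans yt; rewrite lee_fin.
Qed.

(** The extension by 0 to x <= 0 makes the superlevel sets on the whole line exactly intervals (0,
    c), as measurability and equimeasurability require. *)
Definition pos_rearrangement (x : R) : \bar R :=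
  if (0 < x)%R then rearrangement mu u x else 0.

Lemma pos_rearrangement_ge0 x : 0 <= pos_rearrangement x.
Proof. by rewrite /pos_rearrangement; case: ifPn => // _; exact: rearrangement_ge0. Qed.

Lemma pos_rearrangement_superlevel (t : R) : (0 <= t)%R ->
  [set x | t%:E < pos_rearrangement x] = pos_itv (mu [set y | t%:E < u y]).
Proof.
move=> t0; apply/seteqP; split => x; rewrite /pos_rearrangement /pos_itv/=.
  by case: ifPn => [x0|_]; [rewrite rearrangement_gt|rewrite lte_fin ltNge t0].
by move=> [-> ?]; rewrite rearrangement_gt.
Qed.

Lemma measurable_pos_rearrangement :
  measurable_fun setT (pos_rearrangement : measurableTypeR R -> \bar R).
Proof.
apply: measurable_superlevelP => [|s s0]; first exact: pos_rearrangement_ge0.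
by rewrite pos_rearrangement_superlevel//; exact: measurable_pos_itv.
Qed.

Lemma pos_rearrangement_equimeasurable (t : R) : (0 <= t)%R ->
  mu [set y | t%:E < u y] = lebesgue_pos R [set x | t%:E < pos_rearrangement x].
Proof. by move=> t0; rewrite pos_rearrangement_superlevel// lebesgue_pos_pos_itv. Qed.

End rearrangement_facts.

Lemma normal_form_operator_rearrangement (R : realType) d (Y : measurableType d)
    (mu : {measure set Y -> \bar R}) (u : Y -> \bar R) (f : R -> \bar R) :
  normal_form_operator (rearrangement mu u) f =
  primitive f \o pos_rearrangement mu u.
Proof. by apply/funext => x; rewrite normal_form_operatorE. Qed.

(** * Boundedness *)

Section positive_operator.
Context (R : realType) d (S : measurableType d) d' (Y : measurableType d').
Variables (l : {measure set S -> \bar R}) (mu : {measure set Y -> \bar R}).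
Variable K : (S -> \bar R) -> (Y -> \bar R).
Hypothesis K0 : forall g, measurable_fun setT g -> (forall s, 0 <= g s) ->
  forall y, 0 <= K g y.
Hypothesis mK : forall g, measurable_fun setT g -> (forall s, 0 <= g s) ->
  measurable_fun setT (K g).
Hypothesis leK : forall g h, measurable_fun setT g -> measurable_fun setT h ->
  (forall s, 0 <= g s) -> (forall s, g s <= h s) -> forall y, K g y <= K h y.

Definition enormc (g : S -> R[i]) (s : S) : \bar R :=
  (ComplexField.Normc.normc (g s))%:E.

Lemma measurable_normc d0 (T : measurableType d0) (g : T -> R[i]) :
  complex_measurable g ->
  measurable_fun setT (fun t => (ComplexField.Normc.normc (g t))%:E).
Proof.
move=> [mre mim]; apply/measurable_EFinP.
rewrite (_ : (fun _ => _) =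
    fun t => Num.sqrt (complex.Re (g t) ^+ 2 + complex.Im (g t) ^+ 2)%R); last first.
  by apply/funext => t; case: (g t).
apply: (measurableT_comp (continuous_measurable_fun (@sqrt_continuous R))).
by apply: measurable_funD; exact: measurable_funX.
Qed.

Lemma normc_ge0 (z : R[i]) : (0 <= ComplexField.Normc.normc z)%R.
Proof. by case: z => a b; rewrite /= sqrtr_ge0. Qed.

Lemma Re_le_normc (z : R[i]) : (`|complex.Re z| <= ComplexField.Normc.normc z)%R.
Proof.
by case: z => a b /=; rewrite -sqrtr_sqr ler_wsqrtr// lerDl sqr_ge0.
Qed.

Lemma Im_le_normc (z : R[i]) : (`|complex.Im z| <= ComplexField.Normc.normc z)%R.
Proof.
by case: z => a b /=; rewrite -sqrtr_sqr ler_wsqrtr// lerDr sqr_ge0.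
Qed.

Lemma normc_le_abs (a b : R) :
  (ComplexField.Normc.normc (Complex a b) <= `|a| + `|b|)%R.
Proof.
rewrite /= -(ger0_norm (addr_ge0 (normr_ge0 a) (normr_ge0 b))) -sqrtr_sqr.
rewrite ler_wsqrtr// sqrrD !real_normK ?num_real//.
by rewrite lerD2r lerDl mulrn_wge0// mulr_ge0.
Qed.

Lemma measurable_fine_op (g : S -> \bar R) : measurable_fun setT g ->
  (forall s, 0 <= g s) -> measurable_fun setT (fine \o K g).
Proof. by move=> mg g0; apply: measurableT_comp => //; exact: mK. Qed.

Lemma complex_extension_measurable (g : S -> R[i]) :
  complex_measurable g -> complex_measurable (complex_extension K g).
Proof.
move=> [mre mim]; split; apply: measurable_funB; apply: measurable_fine_op => //;
  do ?[exact: funepos_ge0|exact: funeneg_ge0];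
  do ?[apply: measurable_funepos|apply: measurable_funeneg]; exact/measurable_EFinP.
Qed.

Lemma real_extension_le (u : S -> R) (h : S -> \bar R) y :
  measurable_fun setT u -> measurable_fun setT h ->
  (forall s, `|u s|%:E <= h s) ->
  (`|real_extension K u y|)%:E <= 2%:E * K h y.
Proof.
move=> mfu mh uh.
have mu' : measurable_fun setT (EFin \o u) by exact/measurable_EFinP.
have h0 s : 0 <= h s by apply: le_trans (uh s).
have Kp : K (funepos (EFin \o u)) y <= K h y.
  apply: leK => //; first exact: measurable_funepos.
  move=> s; apply: le_trans (uh s); rewrite funeposE ge_max !lee_fin normr_ge0.
  by rewrite ler_norm.
have Kn : K (funeneg (EFin \o u)) y <= K h y.
  apply: leK => //; first exact: measurable_funeneg.
  move=> s; apply: le_trans (uh s); rewrite funenegE ge_max !lee_fin normr_ge0.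
  by rewrite -normrN ler_norm.
have Kp0 : 0 <= K (funepos (EFin \o u)) y.
  by apply: K0 => //; exact: measurable_funepos.
have Kn0 : 0 <= K (funeneg (EFin \o u)) y.
  by apply: K0 => //; exact: measurable_funeneg.
rewrite /real_extension; move: Kp Kn Kp0 Kn0.
case: (K h y) => [k| |]//; last 2 first.
  by move=> _ _ _ _; rewrite mulry gtr0_sg// mul1e leey.
  by rewrite leeNy_eq => /eqP ->.
case: (K (funepos _) y) => [a| |]//; case: (K (funeneg _) y) => [b| |]//=.
rewrite -EFinM !lee_fin => ak bk a0 b0.
by rewrite ler_norml; lra.
Qed.

(** Each of the real and imaginary parts costs a factor 2. Any finite constant would do, because
    [bounded_operator] asks only for some bound; the exact norm is defined on non-negative
    functions. *)
Lemma complex_extension_le (g : S -> R[i]) y : complex_measurable g ->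
  (ComplexField.Normc.normc (complex_extension K g y))%:E <= 4%:E * K (enormc g) y.
Proof.
move=> mg; have mn := measurable_normc mg; have [mre mim] := mg.
apply: (@le_trans _ _ (`|real_extension K (fun s => complex.Re (g s)) y|%:E +
                       `|real_extension K (fun s => complex.Im (g s)) y|%:E)).
  by rewrite -EFinD lee_fin normc_le_abs.
have -> : 4%:E = 2%:E + 2%:E :> \bar R by rewrite -EFinD -natrD.
rewrite ge0_muleDl//; apply: leeD; apply: real_extension_le => // s;
  rewrite lee_fin; [exact: Re_le_normc|exact: Im_le_normc].
Qed.

Lemma norm_bound_bounded (p q : \bar R) (C : R) : 0 < q -> (0 <= C)%R ->
  norm_bound l mu K p q C%:E -> bounded_operator l mu K p q.
Proof.
move=> q0 C0 KC; split; first by exists C.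
have H g : in_complex_Lp l p g ->
    complex_Lnorm mu q (complex_extension K g) <= (4 * C)%:E * complex_Lnorm l p g.
  move=> [mg gp]; have mn := measurable_normc mg.
  have n0 s : 0 <= enormc g s by rewrite lee_fin normc_ge0.
  apply: (@le_trans _ _ (Lnorm mu q (fun y => 4%:E * K (enormc g) y))).
    apply: le_Lnorm => //.
    - exact/measurable_normc/complex_extension_measurable.
    - by apply: measurable_funeM; exact: mK.
    - move=> y; rewrite !gee0_abs ?complex_extension_le//.
        by rewrite mule_ge0// K0.
      by rewrite lee_fin normc_ge0.
  rewrite Lnorm_scale//; last exact: mK.
  rewrite EFinM -muleA lee_pmul2l//; exact: KC.
exists (4 * C)%R => g gLp; split; last exact: H.
split; first by apply: complex_extension_measurable; case: gLp.
apply: le_lt_trans (H g gLp) _; case: gLp => _ gp.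
by rewrite lte_mul_pinfty// ?lee_fin ?mulr_ge0//.
Qed.

(** By positivity the complex extension is dominated by [K] applied to the modulus, so boundedness
    can be compared on non-negative functions alone. *)
Lemma bounded_operatorP (p q : \bar R) : 0 < q ->
  bounded_operator l mu K p q <->
  exists2 C : R, (0 <= C)%R & norm_bound l mu K p q C%:E.
Proof.
move=> q0; split => [[[C KC] _]|[C C0 KC]]; last exact: norm_bound_bounded KC.
exists `|C|%R => // g mg g0 gp; apply: le_trans (KC g mg g0 gp) _.
by apply: lee_wpmul2r; rewrite ?Lnorm_ge0// lee_fin ler_norm.
Qed.

End positive_operator.

Section normal_form.
Context (R : realType) d (S : measurableType d) d' (Y : measurableType d').
Variables (lambda : {measure set S -> \bar R})
  (mu : {sigma_finite_measure set Y -> \bar R}).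
Variables (B : Y -> set S) (hB : core_map lambda B).

Let beta y := lambda (B y).
Let b := rearrangement mu beta.
Let K := hardy_operator lambda B.
Let H := normal_form_operator b.
Let m := lebesgue_pos R.
(** The intermediate model: intervals on the line, still indexed by [Y], with the same measures as
    the sets of [B]. *)
Let B' y : set R := pos_itv (beta y).

Lemma core_map_chain : chain lambda B.
Proof.
split; [exact: core_map_measurable hB|exact: core_map_total hB|].
exact: core_map_finite hB.
Qed.

Let cB := core_map_chain.

Lemma core_map_measurable_measure : measurable_fun setT beta.
Proof.
rewrite /beta; have := core_map_measurable_fun hB measurableT.
by under eq_fun do rewrite setTI.
Qed.

Let mbeta := core_map_measurable_measure.

Lemma pos_itv_chain : chain m B'.
Proof.
split => [y|x y|y]; first exact: measurable_pos_itv.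
  by have [h|/ltW h] := leP (beta x) (beta y); [left|right]; exact: pos_itvS.
rewrite /m lebesgue_pos_pos_itv; [exact: chain_finite cB _|exact: measure_ge0].
Qed.

Let cB' := pos_itv_chain.

Lemma pos_itv_measure y : m (B' y) = beta y.
Proof. by rewrite /m lebesgue_pos_pos_itv. Qed.

Let beta0 y : 0 <= beta y. Proof. exact: measure_ge0. Qed.

(** Both sides are norms of the primitive of [f] composed with a function: the rearrangement on the
    left, [beta] on the right. These two are equimeasurable. *)
Lemma normal_form_Lnorm (q : \bar R) (f : R -> \bar R) : 0 < q ->
  measurable_fun setT (f : measurableTypeR R -> \bar R) -> (forall x, 0 <= f x) ->
  Lnorm m q (H f) = Lnorm mu q (hardy_operator m B' f).
Proof.
move=> q0 mff f0; rewrite /H /b normal_form_operator_rearrangement; apply/esym.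
apply: (@equimeasurable_Lnorm R _ _ _ _ mu m _ _ beta) => //.
- exact: sigma_finiteT.
- exact: sigma_finite_lebesgue_pos.
- exact: measurable_pos_rearrangement.
- exact: pos_rearrangement_ge0.
- by move=> t t0; exact: pos_rearrangement_equimeasurable.
- exact: primitive_ge0.
- exact: primitive_ray_like.
Qed.

(** The measure [nu] is left free so that the study of compactness can take [mu] restricted to a
    tail set. *)
Lemma hardy_le_normal_form (p q c : \bar R) (nu : {measure set Y -> \bar R})
    (g : S -> \bar R) :
  1 <= p -> 0 < q -> 0 <= c -> measurable_fun setT g -> (forall s, 0 <= g s) ->
  (forall f : measurableTypeR R -> \bar R, measurable_fun setT f ->
     (forall x, 0 <= f x) -> Lnorm m p f <= Lnorm lambda p g ->
     Lnorm nu q (hardy_operator m B' f) <= c) ->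
  Lnorm nu q (K g) <= c.
Proof.
move=> p1 q0 c0 mg g0; apply: (@chain_transfer R _ _ _ _ _ _ _ _ nu _ _ p) => //.
- by move=> y; rewrite pos_itv_measure.
- by under eq_fun do rewrite pos_itv_measure.
Qed.

Lemma normal_form_le_hardy (p q c : \bar R) (nu : {measure set Y -> \bar R})
    (f : measurableTypeR R -> \bar R) :
  1 <= p -> 0 < q -> 0 <= c -> measurable_fun setT f -> (forall s, 0 <= f s) ->
  (forall g : S -> \bar R, measurable_fun setT g ->
     (forall x, 0 <= g x) -> Lnorm lambda p g <= Lnorm m p f ->
     Lnorm nu q (K g) <= c) ->
  Lnorm nu q (hardy_operator m B' f) <= c.
Proof.
move=> p1 q0 c0 mg g0; apply: (@chain_transfer R _ _ _ _ _ _ _ _ nu _ _ p) => //.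
by move=> y; rewrite pos_itv_measure.
Qed.

Lemma norm_bound_normal_form (p q C : \bar R) : 1 <= p -> 0 < q -> 0 <= C ->
  norm_bound lambda mu K p q C <-> norm_bound m m H p q C.
Proof.
move=> p1 q0 C0; split => KC g mg g0 gp.
  rewrite normal_form_Lnorm//; apply: (@normal_form_le_hardy p) => //.
    by rewrite mule_ge0// Lnorm_ge0.
  move=> h mh h0 hg; apply: le_trans (KC h mh h0 (le_lt_trans hg gp)) _.
  exact: lee_wpmul2l.
apply: (@hardy_le_normal_form p) => //.
  by rewrite mule_ge0// Lnorm_ge0.
move=> h mh h0 hg; rewrite -normal_form_Lnorm//.
apply: le_trans (KC h mh h0 (le_lt_trans hg gp)) _.
exact: lee_wpmul2l.
Qed.

Lemma operator_norm_normal_form (p q : \bar R) : 1 <= p -> 0 < q ->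
  operator_norm lambda mu K p q = normal_form_norm p q b.
Proof.
move=> p1 q0; rewrite /normal_form_norm /operator_norm; congr ereal_inf.
by apply/seteqP; split => C /= [C0 KC]; split => //;
  apply/(norm_bound_normal_form p1 q0 C0).
Qed.

Lemma hardy_mono (g h : S -> \bar R) y : measurable_fun setT g ->
  measurable_fun setT h -> (forall s, 0 <= g s) -> (forall s, g s <= h s) ->
  K g y <= K h y.
Proof.
move=> mg mh g0 gh; apply: ge0_le_integral => //.
- exact: chain_measurable cB _.
- exact: measurable_funTS.
- exact: measurable_funTS.
Qed.

Lemma bounded_hardyP (p q : \bar R) : 0 < q ->
  bounded_operator lambda mu K p q <->
  exists2 C : R, (0 <= C)%R & norm_bound lambda mu K p q C%:E.
Proof.
move=> q0; apply: bounded_operatorP => //.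
- by move=> g mg g0 y; exact: hardy_ge0.
- by move=> g mg g0; exact: measurable_hardy.
- by move=> g h mg mh g0 gh y; exact: hardy_mono.
Qed.

Lemma bounded_normal_formP (p q : \bar R) : 0 < q ->
  bounded_operator m m H p q <->
  exists2 C : R, (0 <= C)%R & norm_bound m m H p q C%:E.
Proof.
move=> q0; apply: bounded_operatorP => //.
- by move=> g mg g0 y; rewrite /H /b normal_form_operator_rearrangement; exact: primitive_ge0.
- move=> g mg g0; rewrite /H /b normal_form_operator_rearrangement.
  apply: measurable_ray_like; [exact: primitive_ge0|exact: primitive_ray_like| |].
  + exact: measurable_pos_rearrangement.
  + exact: pos_rearrangement_ge0.
- move=> g h mg mh g0 gh y; rewrite /H /b !normal_form_operator_rearrangement /=.
  apply: ge0_le_integral => //.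
  + exact: measurable_pos_itv.
  + exact: measurable_funTS.
  + exact: measurable_funTS.
Qed.

Lemma bounded_operator_normal_form (p q : \bar R) : 1 <= p -> 0 < q ->
  bounded_operator lambda mu K p q <-> bounded_operator m m H p q.
Proof.
move=> p1 q0; rewrite (bounded_hardyP _ q0) (bounded_normal_formP _ q0).
by split => -[C C0 KC]; exists C => //;
  apply/(norm_bound_normal_form p1 q0 (C0 : 0 <= C%:E)).
Qed.

End normal_form.

(** * Compactness *)

Lemma cvg_powR (R : realType) (u : nat -> R) (l q : R) : (0 < q)%R ->
  (forall n, 0 <= u n)%R -> u @ \oo --> l ->
  (fun n => u n `^ q)%R @ \oo --> (l `^ q)%R.
Proof.
move=> q0 u0 ul.
have l0 : (0 <= l)%R.
  rewrite -(cvg_lim _ ul)//; apply: limr_ge; [exact: (cvgP _ ul)|exact: nearW].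
(* The power function need not be differentiable at 0, so convergence to 0 is checked directly, with
   the threshold e^(1/q). *)
move: l0; rewrite le_eqVlt => /predU1P[l0|l0].
  rewrite -l0 powR0 ?gt_eqF//; apply/cvgrPdist_lt => e e0.
  have eq0 : (0 < e `^ q^-1)%R by rewrite powR_gt0.
  move: ul => /cvgrPdist_lt/(_ _ eq0); apply: filterS => n.
  rewrite -l0 !sub0r !normrN ger0_norm// ger0_norm ?powR_ge0// => ue.
  rewrite -[ltRHS]powRr1 ?ltW// -(mulVf (lt0r_neq0 q0)) powRrM.
  by rewrite gt0_ltr_powR// nnegrE ?powR_ge0.
apply: (@continuous_cvg _ _ _ _ _ u (fun x => (x `^ q)%R) l) => //.
apply: differentiable_continuous; apply/derivable1_diffP.
by apply: derivable_powR; rewrite in_itv/= l0.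
Qed.

Lemma ultra_fmap (T T' : Type) (f : T -> T') (U : set_system T) :
  UltraFilter U -> UltraFilter (fmap f U).
Proof.
move=> UU; split; first exact: fmap_proper_filter.
move=> G GG sUG; apply/seteqP; split => // A GA.
have [//|UA] := in_ultra_setVsetC (f @^-1` A) UU.
have GAC : G (A `&` ~` A) by apply: filterI => //; exact: sUG.
by have [x []] := filter_ex GAC.
Qed.

(** An ultrafilter finer than [\oo] gives limits for all the sequences at once, by compactness of
    segments. Stage [n] then selects a later index at which sequences 0 to [n] are within 1/(n+1) of
    these limits, so no nested subsequences are formed. *)
Lemma diagonal_subsequence (R : realType) (a : nat -> nat -> R) :
  (forall i, exists M : R, forall n, `|a i n| <= M)%R ->
  exists k : nat -> nat, {homo k : m n / (m < n)%N} /\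
    forall i, cvgn (fun n => a i (k n)).
Proof.
move=> ab.
have [U [UU sU]] := @ultraFilterLemma nat \oo _.
have cvU i : exists L : R, a i x @[x --> U] --> L.
  have [M aM] := ab i.
  have := @segment_compact R (- M)%R M; rewrite compact_ultra => /(_ (a i x @[x --> U])).
  case=> [||L [_ aL]]; last by exists L.
    exact: ultra_fmap.
  apply: (@filterS _ U _ setT) => [n _|]; last exact: filterT.
  by rewrite /= in_itv/= -ler_norml.
have [L LP] := choice cvU.
have stepP (k j : nat) : exists n, (j < n)%N /\
    forall i, (i <= k)%N -> (`|L i - a i n| < k.+1%:R^-1)%R.
  have near1 i : U [set n | (`|L i - a i n| < k.+1%:R^-1)%R].
    by have := LP i => /cvgrPdist_lt; apply; rewrite invr_gt0.
  have near2 K : U [set n | forall i, (i < K)%N -> (`|L i - a i n| < k.+1%:R^-1)%R].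
    elim: K => [|K IH]; first by apply: (@filterS _ U _ setT) => //; exact: filterT.
    apply: filterS2 IH (near1 K) => n h1 h2 i; rewrite ltnS leq_eqVlt.
    by move=> /predU1P[->//|]; exact: h1.
  have near3 : U [set n | (j < n)%N] by apply: sU; exists j.+1.
  have near4 := filterI near3 (near2 k.+1).
  have [n [h1 h2]] := filter_ex (near4 _).
  by exists n; split => // i ik; exact: h2.
have [w wP] := choice (fun kj : nat * nat => stepP kj.1 kj.2).
pose k := fix k n := if n is n'.+1 then w (n, k n') else w (0%N, 0%N).
have kS n : (k n < k n.+1)%N by have [] := wP (n.+1, k n).
exists k; split; first by apply: homo_ltn => //; exact: ltn_trans.
move=> i; apply/cvg_ex; exists (L i); apply/cvgrPdist_lt => e e0.
have [N _ NP] := near_infty_natSinv_lt (PosNum e0).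
exists (maxn N i) => // n /=; rewrite geq_max => /andP[Nn iN].
apply: lt_trans (NP n Nn).
by case: n iN {Nn} => [|n] iN; [have [_] := wP (0%N, 0%N)|have [_] := wP (n.+1, k n)];
  apply.
Qed.

(** The sum is at most twice the larger term. This replaces the triangle inequality, which fails for
    q < 1. *)
Lemma powR_add_le (R : realType) (x y q : R) : (0 <= x)%R -> (0 <= y)%R ->
  (0 <= q)%R -> ((x + y) `^ q <= 2 `^ q * (x `^ q + y `^ q))%R.
Proof.
move=> x0 y0 q0; wlog xy : x y x0 y0 / (x <= y)%R => [H|].
  have [xy|yx] := leP x y; first exact: H.
  by rewrite addrC [(x `^ _ + _)%R]addrC; apply: H => //; exact: ltW.
apply: (@le_trans _ _ ((2 * y) `^ q)%R).
  by apply: ge0_ler_powR; rewrite ?nnegrE ?addr_ge0 ?mulr_ge0// mulr_natl mulr2n lerD2r.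
by rewrite powRM// ler_pM2l ?powR_gt0// lerDr powR_ge0.
Qed.

Section chain_hoelder.
Context (R : realType) d (S : measurableType d) (l : {measure set S -> \bar R}).

(** Hoelder's inequality against an indicator, drawn from [average_step] with both sets equal to
    [D]: the mean c satisfies c^p e <= M^p, and c e is the integral. *)
Lemma integral_set_hoelder (p M e : R) (D : set S) (g : S -> \bar R) :
  (1 < p)%R -> (0 <= M)%R -> measurable D -> l D = e%:E -> measurable_fun setT g ->
  (forall s, 0 <= g s) -> Lnorm l p%:E g <= M%:E ->
  \int[l]_(s in D) g s <= (M * e `^ (1 - p^-1))%:E.
Proof.
move=> p1 M0 mD De mg g0 gM; have p0 : (0 < p)%R by rewrite (lt_trans ltr01).
have e0 : (0 <= e)%R by rewrite -lee_fin -De.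
have Doo : l D < +oo by rewrite De ltry.
have [c [c0 <- /(_ p (ltW p1)) cp _]] := average_step mD mD erefl Doo mg g0.
have {}cp : c `^ p * l D <= M%:E `^ p.
  apply: (le_trans cp); move: gM; rewrite Lnorm_leP//; apply: le_trans.
  under [leRHS]eq_integral do rewrite gee0_abs//.
  apply: ge0_subset_integral => //; first exact: measurable_poweR_comp.
  by move=> *; exact: poweR_ge0.
move: e0; rewrite le_eqVlt => /predU1P[e0|e0].
  rewrite De -e0 mule0 lee_fin mulr_ge0// powR_ge0.
move: cp c0; rewrite De; case: c => [c| |]//; last first.
  rewrite poweRyr ?gt_eqF// gt0_mulye ?lte_fin// poweR_EFin leye_eq => /eqP.
rewrite !poweR_EFin -EFinM !lee_fin => cp c0.
have cM : (c * e `^ p^-1 <= M)%R.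
  rewrite -[leLHS](powRr1 _) ?mulr_ge0 ?powR_ge0// -[leRHS](powRr1 M0).
  rewrite -(mulfV (lt0r_neq0 p0)) !powRrM; apply: ge0_ler_powR.
  - by rewrite invr_ge0 ltW.
  - by rewrite nnegrE powR_ge0.
  - by rewrite nnegrE powR_ge0.
  by rewrite powRM ?powR_ge0// -powRrM mulVf ?gt_eqF// powRr1// ltW.
have -> : (c * e = c * e `^ p^-1 * e `^ (1 - p^-1))%R.
  rewrite -mulrA -powRD; last by rewrite (gt_eqF e0) implybT.
  by rewrite addrC subrK powRr1 ?ltW.
by rewrite ler_wpM2r// powR_ge0.
Qed.

End chain_hoelder.

Lemma fatou_powR (R : realType) d (Y : measurableType d)
    (mu : {measure set Y -> \bar R}) (D : set Y) (q : R) (c : \bar R)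
    (u_ : nat -> Y -> R) (u : Y -> R) :
  (0 < q)%R -> measurable D -> (forall n, measurable_fun setT (u_ n)) ->
  (forall n y, 0 <= u_ n y)%R -> (forall y, u_ n y @[n --> \oo] --> u y) ->
  (forall n : nat, \int[mu]_(y in D) (u_ n y `^ q)%:E <= c) ->
  \int[mu]_(y in D) (u y `^ q)%:E <= c.
Proof.
move=> q0 mD mu_ u0 uu uc.
have cvq y : (u_ n y `^ q)%:E @[n --> \oo] --> (u y `^ q)%:E.
  by apply: cvg_EFin; [exact: nearW|exact: cvg_powR].
have mq n : measurable_fun D (fun y => (u_ n y `^ q)%:E).
  apply/measurable_EFinP/measurable_funTS.
  exact: (measurableT_comp (measurable_powR q)).
rewrite (_ : integral _ _ _ =
    \int[mu]_(y in D) limn_einf (fun n => (u_ n y `^ q)%:E)); last first.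
  apply: eq_integral => y _; rewrite is_cvg_limn_einfE; last exact: (cvgP _ (cvq y)).
  by rewrite (cvg_lim _ (cvq y)).
apply: le_trans (fatou _ mD mq _) _ => [n y _|]; first by rewrite lee_fin powR_ge0.
rewrite limn_einf_lim; apply: lime_le; first exact: is_cvg_einfs.
apply: nearW => n; apply: le_trans (uc n).
by apply: ereal_inf_lbound; exists n => /=.
Qed.

Section compactness_criterion.
Context (R : realType) d (S : measurableType d) (l : {measure set S -> \bar R}).
Context dY (Y : measurableType dY) (mu : {measure set Y -> \bar R}).
Context (A : Y -> set S) (cA : chain l A).
Hypothesis mlA : measurable_fun setT (fun y => l (A y)).
Variables (p q : R).
Hypotheses (p1 : (1 < p)%R) (q0 : (0 < q)%R).

Let K := hardy_operator l A.
Let beta y := l (A y).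
Let rbeta y : R := fine (beta y).
Let g_ := (1 - p^-1)%R.

Let betaE y : beta y = (rbeta y)%:E.
Proof. by rewrite /rbeta fineK// (chain_fin_num cA). Qed.

Let p0 : (0 < p)%R. Proof. by rewrite (lt_trans ltr01). Qed.

Let gamma0 : (0 < g_)%R. Proof. by rewrite subr_gt0 invf_lt1. Qed.

(** On these sets the operator is uniformly bounded on balls of L^p, and for a bounded operator
    their [mu]-measure is finite, which is what dominated convergence needs. They increase to the
    set where [l (A y)] is positive. *)
Definition middle n := [set y | (n.+1%:R^-1)%:E < l (A y) /\ l (A y) <= n.+1%:R%:E].

Lemma measurable_middle_set n : measurable (middle n).
Proof. exact: measurable_middle. Qed.

(** Allowing every radius [M] spares rescaling to the unit ball. *)
Definition vanishing_tails := forall M e : R, (0 <= M)%R -> (0 < e)%R ->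
  exists n, forall g : S -> \bar R, measurable_fun setT g -> (forall s, 0 <= g s) ->
    Lnorm l p%:E g <= M%:E ->
    \int[mu]_(y in ~` middle n) hardy_operator l A g y `^ q <= e%:E.

Section bounded_function.
Variables (M : R) (g : S -> \bar R).
Hypotheses (M0 : (0 <= M)%R) (mg : measurable_fun setT g) (g0 : forall s, 0 <= g s).
Hypothesis gM : Lnorm l p%:E g <= M%:E.

Lemma hardy_le y : K g y <= (M * rbeta y `^ g_)%:E.
Proof.
apply: integral_set_hoelder => //; first exact: (chain_measurable cA).
exact: betaE.
Qed.

Lemma hardy_fin_num y : K g y \is a fin_num.
Proof.
rewrite ge0_fin_numE ?hardy_ge0//; exact: le_lt_trans (hardy_le y) (ltry _).
Qed.

Lemma hardyE y : K g y = (fine (K g y))%:E.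
Proof. by rewrite fineK// hardy_fin_num. Qed.

Lemma fine_hardy_ge0 y : (0 <= fine (K g y))%R.
Proof. by rewrite fine_ge0// hardy_ge0. Qed.

Lemma fine_hardy_le y : (fine (K g y) <= M * rbeta y `^ g_)%R.
Proof. by rewrite -lee_fin -hardyE hardy_le. Qed.

Lemma hardy_modulus y z : (rbeta z <= rbeta y)%R ->
  (`|fine (K g y) - fine (K g z)| <= M * (rbeta y - rbeta z) `^ g_)%R.
Proof.
move=> zy; have zy' : beta z <= beta y by rewrite !betaE lee_fin.
have mD : measurable (A y `\` A z).
  by apply: measurableD; exact: (chain_measurable cA).
have De : l (A y `\` A z) = (rbeta y - rbeta z)%:E.
  by rewrite (chain_diff_measure cA)// EFinB -!betaE.
have := integral_set_hoelder p1 M0 mD De mg g0 gM.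
have : K g y = K g z + \int[l]_(x in A y `\` A z) g x.
  by rewrite /K /hardy_operator (chain_integralD cA zy' mg g0).
rewrite (hardyE y) (hardyE z).
set I := integral _ _ _; have I0 : 0 <= I by exact: integral_ge0.
case: I I0 => [I| |]// I0; rewrite -EFinD lee_fin => -[->] Ile.
by rewrite addrAC subrr add0r ger0_norm.
Qed.

End bounded_function.

(* Convergence at countably many points suffices by the modulus of continuity. *)
Lemma pointwise_subsequence (M : R) (v : nat -> S -> \bar R) : (0 <= M)%R ->
  (forall n, measurable_fun setT (v n)) -> (forall n s, 0 <= v n s) ->
  (forall n : nat, Lnorm l p%:E (v n) <= M%:E) ->
  exists k : nat -> nat, {homo k : m n / (m < n)%N} /\
    forall y, cvgn (fun n => fine (K (v (k n)) y)).
Proof.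
move=> M0 mv v0 vM.
have [z zP] := dense_from_below rbeta.
have [|k [hk cvk]] := @diagonal_subsequence R (fun i n => fine (K (v n) (z i))).
  move=> i; exists (M * rbeta (z i) `^ g_)%R => n.
  rewrite ger0_norm; last exact: fine_hardy_ge0.
  exact: fine_hardy_le.
exists k; split => // y; apply/cauchy_cvgP/cauchy_exP => e e0 /=.
have e2 : (0 < e / 2)%R by rewrite divr_gt0.
(* At the distance in [t0] the modulus of continuity is at most e/2; [M + 1] replaces [M], which may
   be 0, in the denominator. *)
have M1 : (0 < M + 1)%R by rewrite ltr_wpDl.
have t0 : (0 < (e / 2 / (M + 1)) `^ g_^-1)%R by rewrite powR_gt0// divr_gt0.
have [i [iy yi]] := zP y _ t0.
have close n : (`|fine (K (v (k n)) y) - fine (K (v (k n)) (z i))| <= e / 2)%R.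
  apply: le_trans (hardy_modulus M0 (mv _) (v0 _) (vM _) iy) _.
  apply: (@le_trans _ _ ((M + 1) * (e / 2 / (M + 1)))%R); last first.
    by rewrite mulrC divfK// gt_eqF.
  apply: ler_pM => //; [exact: powR_ge0|by rewrite lerDl|].
  have -> : (e / 2 / (M + 1) = ((e / 2 / (M + 1)) `^ g_^-1) `^ g_)%R.
    by rewrite -powRrM mulVf ?gt_eqF// powRr1// ltW ?divr_gt0.
  apply: ge0_ler_powR; rewrite ?(ltW gamma0)// ?nnegrE ?powR_ge0 ?subr_ge0//.
  by rewrite lerBlDr addrC -lerBlDr ltW.
have /cvg_ex[/= L /cvgrPdist_lt/(_ _ e2) cvL] := cvk i.
exists L; apply: filterS cvL => n Ln; rewrite /ball/=.
rewrite (_ : (L - _ = (L - fine (K (v (k n)) (z i))) +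
   (fine (K (v (k n)) (z i)) - fine (K (v (k n)) y)))%R); last by rewrite addrA subrK.
rewrite (le_lt_trans (ler_normD _ _))// (splitr e) ltr_leD// distrC.
exact: close.
Qed.

Lemma measurable_fine_hardy (g : S -> \bar R) : measurable_fun setT g ->
  (forall s, 0 <= g s) -> measurable_fun setT (fun y => fine (K g y)).
Proof. by move=> mg g0; apply: measurableT_comp => //; exact: measurable_hardy. Qed.

Section convergence.
Variables (M : R) (v : nat -> S -> \bar R) (w : Y -> R).
Hypotheses (M0 : (0 <= M)%R) (mv : forall n, measurable_fun setT (v n)).
Hypotheses (v0 : forall n s, 0 <= v n s).
Hypothesis vM : forall n : nat, Lnorm l p%:E (v n) <= M%:E.
Hypothesis vw : forall y, fine (K (v n) y) @[n --> \oo] --> w y.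

Lemma pointwise_limit_ge0 y : (0 <= w y)%R.
Proof.
rewrite -(cvg_lim _ (@vw y))//; apply: limr_ge; first exact: (cvgP _ (@vw y)).
by apply: nearW => n; exact: fine_hardy_ge0.
Qed.

Lemma measurable_pointwise_limit : measurable_fun setT w.
Proof.
apply: measurable_fun_cvg => [n|y _]; last exact: vw.
exact: measurable_fine_hardy.
Qed.

Lemma hardy_powerE n y : K (v n) y `^ q = (fine (K (v n) y) `^ q)%:E.
Proof. by rewrite (hardyE M0 (mv n) (v0 n) (vM n)) poweR_EFin. Qed.

(** On a tail the functions are uniformly small, and so is their limit by Fatou; on the middle,
    dominated convergence applies with a constant bound. *)
Lemma hardy_cvg_Lq : vanishing_tails ->
  (forall n, mu (middle n) < +oo) ->
  \int[mu]_y (`|fine (K (v n) y) - w y| `^ q)%:E @[n --> \oo] --> 0.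
Proof.
move=> VT midoo.
have mw := measurable_pointwise_limit.
have mdiff n (D : set Y) :
    measurable_fun D (fun y => (`|fine (K (v n) y) - w y| `^ q)%:E).
  apply/measurable_EFinP/measurable_funTS.
  apply: (measurableT_comp (measurable_powR q)); apply: measurableT_comp => //.
  by apply: measurable_funB => //; exact: measurable_fine_hardy.
have mpow (f : Y -> R) (D : set Y) : measurable_fun setT f ->
    measurable_fun D (fun y => (f y `^ q)%:E).
  move=> mf; apply/measurable_EFinP/measurable_funTS.
  exact: (measurableT_comp (measurable_powR q)).
have H (e : R) : (0 < e)%R ->
    \forall n \near \oo, \int[mu]_y (`|fine (K (v n) y) - w y| `^ q)%:E <= e%:E.
  move=> e0; have e3 : (0 < e / 3)%R by rewrite divr_gt0.
  have [n0 tailP] := VT M (e / 3)%R M0 e3.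
  have mD := measurable_middle_set n0; have mDc := measurableC mD.
  have tailn n : \int[mu]_(y in ~` middle n0) (fine (K (v n) y) `^ q)%:E
      <= (e / 3)%:E.
    apply: le_trans (tailP _ (mv n) (v0 n) (vM n)).
    by under [leRHS]eq_integral do rewrite hardy_powerE.
  have tailw : \int[mu]_(y in ~` middle n0) (w y `^ q)%:E <= (e / 3)%:E.
    apply: (fatou_powR q0 mDc _ _ (@vw) tailn) => n; first exact: measurable_fine_hardy.
    by move=> y; exact: fine_hardy_ge0.
  (* For non-negative a and b, |a - b|^q <= max(a, b)^q <= a^q + b^q. This spends two of the three
     shares e/3. *)
  have tail n : \int[mu]_(y in ~` middle n0) (`|fine (K (v n) y) - w y| `^ q)%:E
      <= (e / 3)%:E + (e / 3)%:E.
    apply: (@le_trans _ _ (\int[mu]_(y in ~` middle n0)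
       ((fine (K (v n) y) `^ q)%:E + (w y `^ q)%:E))); last first.
      have n1 y : (~` middle n0) y -> 0 <= (fine (K (v n) y) `^ q)%:E.
        by move=> _; rewrite lee_fin powR_ge0.
      have n2 y : (~` middle n0) y -> 0 <= (w y `^ q)%:E.
        by move=> _; rewrite lee_fin powR_ge0.
      have m1 := mpow _ (~` middle n0) (measurable_fine_hardy (mv n) (v0 n)).
      have m2 := mpow _ (~` middle n0) mw.
      by rewrite ge0_integralD//; exact: leeD.
    apply: ge0_le_integral => //.
    - by apply: emeasurable_funD; apply: mpow => //; exact: measurable_fine_hardy.
    - move=> y _; rewrite -EFinD lee_fin.
      have a0 : (0 <= fine (K (v n) y))%R by exact: fine_hardy_ge0.
      have b0 := pointwise_limit_ge0 y.
      have [ab|ba] := leP (fine (K (v n) y)) (w y).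
        apply: (@le_trans _ _ (w y `^ q)%R); last by rewrite lerDr powR_ge0.
        by apply: ge0_ler_powR; rewrite ?nnegrE ?(ltW q0)// ler0_norm; lra.
      apply: (@le_trans _ _ (fine (K (v n) y) `^ q)%R); last by rewrite lerDl powR_ge0.
      by apply: ge0_ler_powR; rewrite ?nnegrE ?(ltW q0)// ger0_norm; lra.
  pose C := (M * n0.+1%:R `^ g_)%R.
  have C0 : (0 <= C)%R by rewrite mulr_ge0// powR_ge0.
  have vC n y : middle n0 y -> (fine (K (v n) y) <= C)%R.
    move=> [_]; rewrite -/(beta y) betaE lee_fin => yn.
    apply: le_trans (fine_hardy_le M0 (mv n) (v0 n) (vM n) y) _.
    rewrite ler_wpM2l//; apply: ge0_ler_powR; rewrite ?nnegrE ?(ltW gamma0)//.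
    by rewrite fine_ge0//; exact: measure_ge0.
  have mid0 : \int[mu]_(y in middle n0) (`|fine (K (v n) y) - w y| `^ q)%:E
      @[n --> \oo] --> 0.
    rewrite -(integral0 mu (middle n0)).
    apply: (@dominated_cvg _ _ _ mu _ mD _ _ (cst ((C + C) `^ q)%:E)) => //.
    - move=> y _; apply: cvg_EFin; first exact: nearW.
      rewrite -(powR0 (lt0r_neq0 q0)); apply: cvg_powR => //.
      by apply/norm_cvg0P; rewrite -(subrr (w y)); apply: cvgB => //; exact: cvg_cst.
    - apply/integrableP; split; first exact: measurable_cst.
      have /= -> := integral_cst mu mD `|((C + C) `^ q)%:E|.
      by rewrite lte_mul_pinfty.
    - move=> n y my; rewrite gee0_abs ?lee_fin ?powR_ge0//.
      have a0 : (0 <= fine (K (v n) y))%R by exact: fine_hardy_ge0.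
      have b0 := pointwise_limit_ge0 y.
      have aC := vC n y my.
      have bC : (w y <= C)%R.
        rewrite -(cvg_lim _ (@vw y))//; apply: limr_le; first exact: (cvgP _ (@vw y)).
        by apply: nearW => k; exact: vC.
      apply: ge0_ler_powR; rewrite ?nnegrE ?(ltW q0) ?addr_ge0//.
      by rewrite ler_norml; lra.
  have midle : \forall n \near \oo,
      \int[mu]_(y in middle n0) (`|fine (K (v n) y) - w y| `^ q)%:E <= (e / 3)%:E.
    move/fine_cvgP : mid0 => [fin /cvgrPdist_le/(_ _ e3)].
    apply: filterS2 fin => n fin; rewrite sub0r normrN /= => h.
    rewrite -(fineK fin) lee_fin; apply: le_trans h; exact: ler_norm.
  apply: filterS midle => n midn.
  rewrite -[X in \int[mu]_(y in X) _](setvU (middle n0)) ge0_integral_setU//.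
  - apply: le_trans (leeD (tail n) midn) _.
    by rewrite -!EFinD lee_fin; lra.
  - by apply/disj_setPS => y [].
have I0 n : 0 <= \int[mu]_y (`|fine (K (v n) y) - w y| `^ q)%:E.
  by apply: integral_ge0 => *; rewrite lee_fin powR_ge0.
apply/fine_cvgP; split.
  apply: filterS (H 1%R ltr01) => n h.
  by rewrite ge0_fin_numE// (le_lt_trans h)// ltry.
apply/cvgrPdist_le => e e0; apply: filterS (H e e0) => n h.
rewrite sub0r normrN /= ger0_norm; last exact: fine_ge0.
by rewrite -lee_fin fineK// ge0_fin_numE// (le_lt_trans h)// ltry.
Qed.

End convergence.

End compactness_criterion.

Lemma cvge0P (R : realType) (u : nat -> \bar R) : (forall n, 0 <= u n) ->
  u n @[n --> \oo] --> 0 <->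
  forall e : R, (0 < e)%R -> \forall n \near \oo, u n <= e%:E.
Proof.
move=> u0; split => [/fine_cvgP[fin cv] e e0|H].
  move/cvgrPdist_le : cv => /(_ _ e0); apply: filterS2 fin => n fin.
  rewrite sub0r normrN /= => h; rewrite -(fineK fin) lee_fin.
  by apply: le_trans h; exact: ler_norm.
apply/fine_cvgP; split.
  apply: filterS (H 1%R ltr01) => n h.
  by rewrite ge0_fin_numE// (le_lt_trans h)// ltry.
apply/cvgrPdist_le => e e0; apply: filterS (H e e0) => n h.
rewrite sub0r normrN /= ger0_norm; last exact: fine_ge0.
by rewrite -lee_fin fineK// ge0_fin_numE// (le_lt_trans h)// ltry.
Qed.

Lemma Lnorm_cvg0P (R : realType) d (Y : measurableType d)
    (mu : {measure set Y -> \bar R}) (q : R) (u : nat -> Y -> \bar R) : (0 < q)%R ->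
  Lnorm mu q%:E (u n) @[n --> \oo] --> 0 <->
  \int[mu]_y `|u n y| `^ q @[n --> \oo] --> 0.
Proof.
move=> q0; have I0 n : 0 <= \int[mu]_y `|u n y| `^ q.
  by apply: integral_ge0 => *; exact: poweR_ge0.
rewrite cvge0P; last by move=> n; exact: Lnorm_ge0.
rewrite cvge0P//; split => H e e0.
  have eq0 : (0 < e `^ q^-1)%R by rewrite powR_gt0.
  apply: filterS (H _ eq0) => n; rewrite Lnorm_leP// ?lee_fin ?powR_ge0//.
  by rewrite poweR_EFin -powRrM mulVf ?gt_eqF// powRr1// ltW.
have eq0 : (0 < e `^ q)%R by rewrite powR_gt0.
apply: filterS (H _ eq0) => n h.
by rewrite Lnorm_leP// ?lee_fin ?(ltW e0)// poweR_EFin.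
Qed.

(** Four terms, because the complex extension is built from four values of the operator; the
    constant comes from two nested uses of [powR_add_le]. *)
Lemma integral_pow4_le (R : realType) d (Y : measurableType d)
    (mu : {measure set Y -> \bar R}) (q : R) (z : Y -> R) (x : nat -> Y -> R) :
  (0 < q)%R -> measurable_fun setT z -> (forall y, 0 <= z y)%R ->
  (forall i, measurable_fun setT (x i)) -> (forall i y, 0 <= x i y)%R ->
  (forall y, z y <= (x 0%N y + x 1%N y) + (x 2%N y + x 3%N y))%R ->
  \int[mu]_y (z y `^ q)%:E <= (2 `^ q * 2 `^ q)%:E *
    ((\int[mu]_y (x 0 y `^ q)%:E + \int[mu]_y (x 1 y `^ q)%:E) +
     (\int[mu]_y (x 2 y `^ q)%:E + \int[mu]_y (x 3 y `^ q)%:E)).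
Proof.
move=> q0 mz z0 mx x0 zx.
have mpow (f : Y -> R) : measurable_fun setT f ->
    measurable_fun setT (fun y => (f y `^ q)%:E).
  move=> mf; apply/measurable_EFinP; exact: (measurableT_comp (measurable_powR q)).
have xi0 i y : setT y -> 0 <= (x i y `^ q)%:E by move=> _; rewrite lee_fin powR_ge0.
have mxi i := mpow _ (mx i).
have xij0 i j y : setT y -> 0 <= (x i y `^ q)%:E + (x j y `^ q)%:E.
  by move=> _; rewrite adde_ge0// lee_fin powR_ge0.
have mxij i j : measurable_fun setT (fun y => (x i y `^ q)%:E + (x j y `^ q)%:E).
  exact: emeasurable_funD.
have c0 : 0 <= (2 `^ q * 2 `^ q)%:E :> \bar R by rewrite lee_fin mulr_ge0// powR_ge0.
apply: (@le_trans _ _ (\int[mu]_y ((2 `^ q * 2 `^ q)%:E *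
   (((x 0 y `^ q)%:E + (x 1 y `^ q)%:E) + ((x 2 y `^ q)%:E + (x 3 y `^ q)%:E)))));
    last first.
  rewrite ge0_integralZl//; last 2 first.
  - exact: emeasurable_funD.
  - by move=> y _; apply: adde_ge0; exact: xij0.
  rewrite ge0_integralD//; do ?exact: xij0.
  by rewrite !ge0_integralD//; do ?exact: xi0.
apply: ge0_le_integral => //.
- by move=> *; rewrite lee_fin powR_ge0.
- exact: mpow.
- by apply: measurable_funeM; exact: emeasurable_funD.
move=> y _; rewrite -!EFinD -EFinM lee_fin.
have a0 : (0 <= x 0%N y + x 1%N y)%R by rewrite addr_ge0.
have b0 : (0 <= x 2%N y + x 3%N y)%R by rewrite addr_ge0.
apply: (@le_trans _ _ ((x 0%N y + x 1%N y + (x 2%N y + x 3%N y)) `^ q)%R).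
  by apply: ge0_ler_powR; rewrite ?nnegrE ?(ltW q0)// addr_ge0.
apply: le_trans (powR_add_le a0 b0 (ltW q0)) _.
rewrite -mulrA ler_pM2l ?powR_gt0// mulrDr.
by apply: lerD; apply: powR_add_le => //; exact: ltW.
Qed.

Lemma complexB (R : realType) (a b c e : R) :
  (Complex a b - Complex c e)%R = Complex (a - c)%R (b - e)%R.
Proof. by []. Qed.

(** The numbering allows subsequences to be extracted for the four functions by induction. *)
Definition part (R : realType) (S : Type) (i : nat) (g : S -> R[i]) : S -> \bar R :=
  match i with
  | 0 => funepos (EFin \o (fun s => complex.Re (g s)))
  | 1 => funeneg (EFin \o (fun s => complex.Re (g s)))
  | 2 => funepos (EFin \o (fun s => complex.Im (g s)))
  | _ => funeneg (EFin \o (fun s => complex.Im (g s)))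
  end.

Section part_facts.
Context (R : realType) d (S : measurableType d).
Implicit Type g : S -> R[i].

Lemma part_ge0 i g s : 0 <= part i g s.
Proof.
by case: i => [|[|[|i]]]; [exact: funepos_ge0|exact: funeneg_ge0
  |exact: funepos_ge0|exact: funeneg_ge0].
Qed.

Lemma measurable_part i g : complex_measurable g -> measurable_fun setT (part i g).
Proof.
by move=> [mre mim]; case: i => [|[|[|i]]];
  [apply: measurable_funepos|apply: measurable_funeneg
  |apply: measurable_funepos|apply: measurable_funeneg]; exact/measurable_EFinP.
Qed.

Lemma part_le_normc i g s : part i g s <= (ComplexField.Normc.normc (g s))%:E.
Proof.
have r := Re_le_normc (g s); have j := Im_le_normc (g s); have n0 := normc_ge0 (g s).
case: i => [|[|[|i]]]; rewrite /= ?funeposE ?funenegE /= ge_max !lee_fin n0 andbT.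
- exact: le_trans (ler_norm _) r.
- by apply: le_trans r; rewrite -normrN ler_norm.
- exact: le_trans (ler_norm _) j.
- by apply: le_trans j; rewrite -normrN ler_norm.
Qed.

Lemma part_Lnorm_le (l : {measure set S -> \bar R}) p i g : 0 < p ->
  complex_measurable g -> Lnorm l p (part i g) <= complex_Lnorm l p g.
Proof.
move=> p0 mg; apply: le_Lnorm => //; first exact: measurable_part.
  exact: measurable_normc.
by move=> s; rewrite !gee0_abs ?part_le_normc ?part_ge0// lee_fin normc_ge0.
Qed.

End part_facts.

(** * Equivalence of compactness and vanishing tails *)

Section compact_iff_vanishing_tails.
Context (R : realType) d (S : measurableType d) (l : {measure set S -> \bar R}).
Context dY (Y : measurableType dY) (mu : {measure set Y -> \bar R}).
Context (A : Y -> set S) (cA : chain l A).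
Hypothesis mlA : measurable_fun setT (fun y => l (A y)).
Variables (p q : R).
Hypotheses (p1 : (1 < p)%R) (q0 : (0 < q)%R).

Let K := hardy_operator l A.
Let p0 : (0 < p)%R. Proof. by rewrite (lt_trans ltr01). Qed.

(* The test function is the indicator of [(0, t)], transferred to [S]. *)
Lemma superlevel_bound (C t : R) : (0 <= C)%R -> (0 < t)%R ->
  norm_bound l mu K p%:E q%:E C%:E ->
  (t `^ q)%:E * mu [set y | t%:E < l (A y)] <= ((C * t `^ p^-1) `^ q)%:E.
Proof.
move=> C0 t0 KC.
pose B y : set R := pos_itv (l (A y)).
have lB y : lebesgue_pos R (B y) = l (A y) by rewrite lebesgue_pos_pos_itv.
have cB : chain (lebesgue_pos R) B.
  split => [y|x y|y]; first exact: measurable_pos_itv.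
    by have [h|/ltW h] := leP (l (A x)) (l (A y)); [left|right]; exact: pos_itvS.
  by rewrite lB; exact: (chain_finite cA).
have mI := @measurable_pos_itv R t%:E.
pose f : measurableTypeR R -> \bar R := fun x => (\1_(pos_itv t%:E : set R) x)%:E.
have mf : measurable_fun setT f.
  by apply/measurable_EFinP; exact: measurable_indic.
have f0 x : 0 <= f x by rewrite lee_fin.
have fnorm : Lnorm (lebesgue_pos R) p%:E f = (t `^ p^-1)%:E.
  rewrite unlock -poweR_EFin; congr (_ `^ _).
  rewrite (_ : (fun x => _) = f); last first.
    apply/funext => x; rewrite /f indicE; case: (_ \in _) => /=.
      by rewrite normr1 powR1.
    by rewrite normr0 powR0// gt_eqF.
  rewrite /f integral_indic// setIT lebesgue_pos_pos_itv//.
  by rewrite lee_fin ltW.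
have : Lnorm mu q%:E (hardy_operator (lebesgue_pos R) B f) <= (C * t `^ p^-1)%:E.
  apply: (@chain_transfer R _ _ _ _ l (lebesgue_pos R) _ _ mu A B p%:E q%:E _ f) => //.
  - by rewrite lee_fin ltW.
  - by rewrite lee_fin mulr_ge0// powR_ge0.
  - move=> h mh h0; rewrite fnorm => hf.
    apply: le_trans (KC h mh h0 (le_lt_trans hf (ltry _))) _.
    by rewrite EFinM lee_wpmul2l// lee_fin.
rewrite Lnorm_leP//; last by rewrite lee_fin mulr_ge0// powR_ge0.
rewrite poweR_EFin; apply: le_trans.
have ml : measurable [set y | t%:E < l (A y)] by exact: measurable_superlevel.
rewrite -integral_cst//.
have mh : measurable_fun setT
    (fun y => `|hardy_operator (lebesgue_pos R) B f y| `^ q).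
  apply: measurable_abse_poweR; apply: measurable_hardy => //.
  by under eq_fun do rewrite lB.
apply: (@le_trans _ _ (\int[mu]_(y in [set y | t%:E < l (A y)])
   `|hardy_operator (lebesgue_pos R) B f y| `^ q)); last first.
  by apply: ge0_subset_integral => // *; exact: poweR_ge0.
apply: ge0_le_integral => //.
- by move=> y _ /=; rewrite lee_fin powR_ge0.
- exact: measurable_funTS.
(* Here (0, t) is contained in [B y], so the operator takes the value [t]: the estimate is
   Chebyshev's inequality. *)
- move=> y /= ty.
  rewrite /hardy_operator /f integral_indic//; last exact: measurable_pos_itv.
  rewrite setIidl; last by apply: pos_itvS; exact: ltW.
  rewrite lebesgue_pos_pos_itv ?lee_fin ?(ltW t0)//.
  by rewrite ger0_norm ?(ltW t0).
Qed.

Lemma superlevel_finite (C t : R) : (0 <= C)%R -> (0 < t)%R ->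
  norm_bound l mu K p%:E q%:E C%:E -> mu [set y | t%:E < l (A y)] < +oo.
Proof.
move=> C0 t0 KC; have := superlevel_bound C0 t0 KC.
case: (mu _) => [r| |]//; first by move=> _; rewrite ltry.
by rewrite gt0_muley ?lte_fin ?powR_gt0// leye_eq.
Qed.

Lemma middle_finite n (C : R) : (0 <= C)%R ->
  norm_bound l mu K p%:E q%:E C%:E -> mu (middle l A n) < +oo.
Proof.
move=> C0 KC; have n0 : (0 < n.+1%:R^-1 :> R)%R by rewrite invr_gt0.
apply: le_lt_trans (superlevel_finite C0 n0 KC); apply: le_measure; rewrite ?inE.
- exact: measurable_middle_set.
- exact: measurable_superlevel.
- by move=> y [].
Qed.

Lemma part_subsequence (N : nat) (g : nat -> S -> R[i]) (M : R) : (0 <= M)%R ->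
  (forall n, complex_measurable (g n)) ->
  (forall n : nat, complex_Lnorm l p%:E (g n) <= M%:E) ->
  exists k : nat -> nat, {homo k : m n / (m < n)%N} /\
    forall i y, (i < N)%N -> cvgn (fun n => fine (K (part i (g (k n))) y)).
Proof.
move=> M0 mg gM; elim: N => [|N [k [hk cvk]]].
  by exists id; split.
have [| | |k' [hk' cvk']] := @pointwise_subsequence R _ S l _ Y A cA p p1 M
    (fun n => part N (g (k n))) M0.
- by move=> n; exact: measurable_part.
- by move=> n s; exact: part_ge0.
- by move=> n; apply: le_trans (gM (k n)); apply: part_Lnorm_le.
exists (k \o k'); split; first by move=> m n mn; apply/hk/hk'.
move=> i y; rewrite ltnS leq_eqVlt => /predU1P[->|iN]; first exact: cvk'.
have /cvg_ex[L cvL] := cvk i y iN; apply/cvg_ex; exists L.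
apply: (cvg_comp k' _ _ cvL).
apply/cvgnyPge => m; exists m => // n /= mn; apply: leq_trans mn _.
elim: n => [//|n IH]; exact: leq_ltn_trans IH (hk' _ _ (ltnSn n)).
Qed.

Lemma integral_normc_poweR (f : Y -> R[i]) :
  \int[mu]_y `|(ComplexField.Normc.normc (f y))%:E| `^ q =
  \int[mu]_y (ComplexField.Normc.normc (f y) `^ q)%:E.
Proof. by apply: eq_integral => y _; rewrite gee0_abs// lee_fin normc_ge0. Qed.

Lemma hardy_bounded_operatorP : bounded_operator l mu K p%:E q%:E <->
  exists2 C : R, (0 <= C)%R & norm_bound l mu K p%:E q%:E C%:E.
Proof.
apply: bounded_operatorP => //.
- by move=> g mg g0 y; exact: hardy_ge0.
- by move=> g mg g0; exact: measurable_hardy.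
- move=> g h mg mh g0 gh y; apply: ge0_le_integral => //.
  + exact: (chain_measurable cA).
  + exact: measurable_funTS.
  + exact: measurable_funTS.
Qed.

Lemma normc_complex_le (a0 a1 a2 a3 : R) :
  (ComplexField.Normc.normc (Complex (a0 - a1) (a2 - a3)) <=
   (`|a0| + `|a1|) + (`|a2| + `|a3|))%R.
Proof.
by apply: le_trans (normc_le_abs _ _) _; apply: lerD; exact: ler_normB.
Qed.

(** The limit is assembled from the pointwise limits for the four parts; each of them is also a
    limit in L^q by [hardy_cvg_Lq]. *)
Lemma vanishing_tails_compact : bounded_operator l mu K p%:E q%:E ->
  vanishing_tails l mu A p q -> compact_operator l mu K p%:E q%:E.
Proof.
move=> bK VT; split => // g gLp [M' gM'].
have [C C0 KC] := hardy_bounded_operatorP.1 bK.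
pose M := `|M'|%R; have M0 : (0 <= M)%R by exact: normr_ge0.
have mg n : complex_measurable (g n) by have [] := gLp n.
have gM n : complex_Lnorm l p%:E (g n) <= M%:E.
  by apply: le_trans (gM' n) _; rewrite lee_fin ler_norm.
have [k [hk cvk]] := part_subsequence 4 M0 mg gM.
pose v i n := part i (g (k n)).
have mv i n : measurable_fun setT (v i n) by exact: measurable_part.
have v0 i n s : 0 <= v i n s by exact: part_ge0.
have vM i n : Lnorm l p%:E (v i n) <= M%:E.
  by apply: le_trans (gM (k n)); apply: part_Lnorm_le.
(* [integral_pow4_le] takes a family indexed by all of [nat], while convergence is known for i < 4;
   capping the index at 3 reconciles the two. *)
pose w i y := limn (fun n => fine (K (v (minn i 3) n) y)).
have vw i y : fine (K (v (minn i 3) n) y) @[n --> \oo] --> w i y.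
  by apply: cvk; rewrite ltnS geq_minr.
pose h y := Complex (w 0%N y - w 1%N y)%R (w 2%N y - w 3%N y)%R.
have mw i : measurable_fun setT (w i).
  exact: (measurable_pointwise_limit cA mlA (mv _) (v0 _) (vw i)).
have w0 i y : (0 <= w i y)%R.
  exact: (pointwise_limit_ge0 (v0 (minn i 3)) (vw i)).
have mh : complex_measurable h by split; apply: measurable_funB.
have mK i n : measurable_fun setT (fun y => fine (K (v i n) y)).
  exact: measurable_fine_hardy.
exists k, h; split => //.
- split => //; rewrite /complex_Lnorm Lnorm_lty//.
  have wfin i : \int[mu]_y (w i y `^ q)%:E <= ((C * M) `^ q)%:E.
    apply: (fatou_powR q0 measurableT (mK (minn i 3)) _ (@vw i)) => [n y|n].
      exact: fine_hardy_ge0.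
    have := KC _ (mv (minn i 3) n) (v0 _ _) (le_lt_trans (vM _ _) (ltry _)).
    move=> /le_trans/(_ (lee_wpmul2l _ (vM _ _))) -/(_ (C0 : 0 <= C%:E)).
    rewrite -EFinM Lnorm_leP ?lee_fin ?mulr_ge0// poweR_EFin; apply: le_trans.
    have E y : `|K (v (minn i 3) n) y| `^ q = (fine (K (v (minn i 3) n) y) `^ q)%:E.
      rewrite gee0_abs ?hardy_ge0// -poweR_EFin; congr (_ `^ _).
      exact: (hardyE cA p1 M0 (mv _ _) (v0 _ _) (vM _ _)).
    by under [leRHS]eq_integral do rewrite E.
  rewrite integral_normc_poweR.
  apply: le_lt_trans (integral_pow4_le mu q0 _ _ mw w0 _) _ => //.
  - exact/measurable_EFinP/measurable_normc.
  - by move=> y; exact: normc_ge0.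
  - move=> y; rewrite /h; apply: le_trans (normc_complex_le _ _ _ _) _.
    by rewrite !ger0_norm.
  rewrite lte_mul_pinfty// ?lee_fin ?mulr_ge0 ?powR_ge0//.
  by do 2 ?apply: lte_add_pinfty; exact: le_lt_trans (wfin _) (ltry _).
- apply/(Lnorm_cvg0P mu _ q0).
  pose x n i y := `|fine (K (v (minn i 3) n) y) - w i y|%R.
  have xcv i : \int[mu]_y (x n i y `^ q)%:E @[n --> \oo] --> 0.
    apply: (hardy_cvg_Lq cA mlA p1 q0 M0 (mv _) (v0 _) (vM _) (vw i) VT).
    by move=> n; apply: middle_finite KC.
  apply/cvge0P => [n|e e0]; first by apply: integral_ge0 => *; exact: poweR_ge0.
  (* The constant of [integral_pow4_le]; four terms of size e/(4c) then add up to [e]. *)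
  pose c := (2 `^ q * 2 `^ q)%R : R.
  have c0 : (0 < c)%R by rewrite mulr_gt0// powR_gt0.
  have d0 : (0 < e / (4 * c))%R by rewrite divr_gt0// mulr_gt0.
  have xle i : \forall n \near \oo, \int[mu]_y (x n i y `^ q)%:E <= (e / (4 * c))%:E.
    have x0 n : 0 <= \int[mu]_y (x n i y `^ q)%:E.
      by apply: integral_ge0 => *; rewrite lee_fin powR_ge0.
    exact: (cvge0P x0).1 (xcv i) _ d0.
  have x01 : \forall n \near \oo, \int[mu]_y (x n 0%N y `^ q)%:E <= (e / (4 * c))%:E /\
      \int[mu]_y (x n 1%N y `^ q)%:E <= (e / (4 * c))%:E.
    by apply: filterS2 (xle 0%N) (xle 1%N) => n; split.
  have x23 : \forall n \near \oo, \int[mu]_y (x n 2%N y `^ q)%:E <= (e / (4 * c))%:E /\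
      \int[mu]_y (x n 3%N y `^ q)%:E <= (e / (4 * c))%:E.
    by apply: filterS2 (xle 2%N) (xle 3%N) => n; split.
  apply: filterS2 x01 x23 => n [a0 a1] [a2 a3].
  rewrite integral_normc_poweR.
  apply: (@le_trans _ _ (c%:E *
    ((\int[mu]_y (x n 0 y `^ q)%:E + \int[mu]_y (x n 1 y `^ q)%:E) +
     (\int[mu]_y (x n 2 y `^ q)%:E + \int[mu]_y (x n 3 y `^ q)%:E)))).
    apply: integral_pow4_le => //.
    - apply/measurable_EFinP/measurable_normc.
      have [m1 m2] : complex_measurable (complex_extension K (g (k n))).
        split; apply: measurable_funB; [exact: (mK 0%N n)|exact: (mK 1%N n)
          |exact: (mK 2%N n)|exact: (mK 3%N n)].
      have [m3 m4] := mh.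
      by split; apply: measurable_funB.
    - by move=> y; exact: normc_ge0.
    - move=> i; apply: measurableT_comp => //; apply: measurable_funB => //.
    - by move=> i y; exact: normr_ge0.
    - move=> y.
      rewrite (_ : (complex_extension K (g (k n)) y - h y)%R = Complex
        ((fine (K (v 0%N n) y) - w 0%N y) - (fine (K (v 1%N n) y) - w 1%N y))%R
        ((fine (K (v 2%N n) y) - w 2%N y) - (fine (K (v 3%N n) y) - w 3%N y))%R).
        exact: normc_complex_le.
      rewrite /complex_extension /h /real_extension.
      by rewrite complexB; congr Complex; rewrite /v /=; ring.
  apply: (@le_trans _ _ (c%:E * (((e / (4 * c))%:E + (e / (4 * c))%:E) +
     ((e / (4 * c))%:E + (e / (4 * c))%:E)))).
    apply: lee_wpmul2l; first by rewrite lee_fin ltW.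
    exact: leeD (leeD a0 a1) (leeD a2 a3).
  rewrite -!EFinD -EFinM lee_fin le_eqVlt; apply/orP; left; apply/eqP.
  by field; rewrite gt_eqF.
Qed.

Lemma le_middle m n : (m <= n)%N -> middle l A m `<=` middle l A n.
Proof.
move=> mn y [ym my]; split.
  by apply: le_lt_trans ym; rewrite lee_fin lef_pV2 ?posrE// ler_nat.
by apply: le_trans my _; rewrite lee_fin ler_nat.
Qed.

(** Compactness is stated for complex functions, which are finite everywhere, so [g] has to be
    replaced by its finite version. By Hoelder [g] is integrable, hence almost everywhere finite, on
    each [A y]. *)
Lemma hardy_fine (g : S -> \bar R) (M : R) : (0 <= M)%R -> measurable_fun setT g ->
  (forall s, 0 <= g s) -> Lnorm l p%:E g <= M%:E ->
  K (EFin \o (fine \o g)) = K g.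
Proof.
move=> M0 mg g0 gM; apply/funext => y.
have mAy : measurable (A y) by exact: (chain_measurable cA).
have mfg : measurable_fun setT (EFin \o (fine \o g)).
  by apply/measurable_EFinP; exact: measurableT_comp.
have gi : l.-integrable (A y) g.
  apply/integrableP; split; first exact: measurable_funTS.
  under eq_integral do rewrite gee0_abs//.
  have := hardy_fin_num cA p1 M0 mg g0 gM y.
  by rewrite ge0_fin_numE// hardy_ge0.
apply: ge0_ae_eq_integral => //.
- exact: measurable_funTS.
- exact: measurable_funTS.
- by move=> s _; rewrite lee_fin fine_ge0.
- by apply: filterS (integrable_ae mAy gi) => s h sA /=; rewrite fineK// h.
Qed.

(* Functions [g n] with large tails would have a subsequence of images converging
   to some [h] in L^q, whose own tails tend to [0]. The points where [l (A y) = 0]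
   belong to all the tails, but [K (g n)] vanishes there, so [h] may be cut off. *)
Lemma compact_vanishing_tails : compact_operator l mu K p%:E q%:E ->
  vanishing_tails l mu A p q.
Proof.
move=> [_ cK] M e M0 e0; apply: contrapT => /forallNP noT.
have {}noT n : exists g : S -> \bar R, [/\ measurable_fun setT g,
    forall s, 0 <= g s, Lnorm l p%:E g <= M%:E &
    e%:E < \int[mu]_(y in ~` middle l A n) K g y `^ q].
  apply: contrapT => H; apply: (noT n) => g mg g0 gM.
  by rewrite leNgt; apply/negP => ge; apply: H; exists g.
have [g gP] := choice noT.
have mg n : measurable_fun setT (g n) by have [] := gP n.
have g0 n s : 0 <= g n s by have [] := gP n.
have gM n : Lnorm l p%:E (g n) <= M%:E by have [] := gP n.
pose G n s := Complex (fine (g n s)) 0%R.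
have mG n : complex_measurable (G n).
  by split; [exact: measurableT_comp|exact: measurable_cst].
have normG n s : ComplexField.Normc.normc (G n s) = fine (g n s).
  by rewrite /= expr0n addr0 sqrtr_sqr ger0_norm// fine_ge0.
have GM n : complex_Lnorm l p%:E (G n) <= M%:E.
  apply: le_trans (gM n); apply: le_Lnorm => //; first exact: measurable_normc.
  move=> s; rewrite normG !gee0_abs ?lee_fin ?fine_ge0//.
  by case: (g n s) (g0 n s) => [r| |]//= _; rewrite leey.
have KG n y : complex_extension K (G n) y = Complex (fine (K (g n) y)) 0%R.
  rewrite /complex_extension /real_extension.
  have K0 : K (cst 0) y = 0 by rewrite /K /hardy_operator integral0.
  have -> : funepos (EFin \o (fun s => complex.Re (G n s))) = EFin \o (fine \o g n).
    apply/funext => s; rewrite funeposE /= max_l// lee_fin; exact: fine_ge0.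
  have -> : funeneg (EFin \o (fun s => complex.Re (G n s))) = cst 0.
    apply/funext => s; rewrite funenegE /= max_r// lee_fin oppr_le0; exact: fine_ge0.
  have -> : funepos (EFin \o (fun s => complex.Im (G n s))) = cst 0.
    by apply/funext => s; rewrite funeposE /= max_l.
  have -> : funeneg (EFin \o (fun s => complex.Im (G n s))) = cst 0.
    by apply/funext => s; rewrite funenegE /= oppr0 max_l.
  by rewrite K0 /= !subr0 (hardy_fine M0).
have [|k [h [hk [mh hq] /(Lnorm_cvg0P mu _ q0) cvh]]] := cK G _ (ex_intro _ M GM).
  by move=> n; split => //; exact: le_lt_trans (GM n) (ltry _).
have n_le_k n : (n <= k n)%N.
  by elim: n => [//|n IH]; exact: leq_ltn_trans IH (hk _ _ (ltnSn n)).
pose phi y : R := if 0 < l (A y) then ComplexField.Normc.normc (h y) else 0%R.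
have phi0 y : (0 <= phi y)%R by rewrite /phi; case: ifPn => // _; exact: normc_ge0.
have mnh : measurable_fun setT (fun y => ComplexField.Normc.normc (h y)).
  exact/measurable_EFinP/measurable_normc.
have mphi : measurable_fun setT phi.
  by apply: measurable_fun_ifT => //; apply: measurable_fun_lte.
have mpow (f : Y -> R) (D : set Y) : measurable_fun setT f ->
    measurable_fun D (fun y => (f y `^ q)%:E).
  move=> mf; apply/measurable_EFinP/measurable_funTS.
  exact: (measurableT_comp (measurable_powR q)).
have phioo : \int[mu]_y (phi y `^ q)%:E < +oo.
  move: hq; rewrite /complex_Lnorm Lnorm_lty// integral_normc_poweR.
  apply: le_lt_trans; apply: ge0_le_integral => //.
  - by move=> *; rewrite lee_fin powR_ge0.
  - exact: mpow.
  - exact: mpow.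
  - move=> y _; rewrite lee_fin; apply: ge0_ler_powR;
      rewrite ?nnegrE ?(ltW q0) ?normc_ge0//.
    by rewrite /phi; case: ifPn => // _; exact: normc_ge0.
pose dl n y := (complex_extension K (G (k n)) y - h y)%R.
have mdl n : complex_measurable (dl n).
  have mk : measurable_fun setT (fun y => fine (K (g (k n)) y)).
    exact: measurable_fine_hardy.
  have [m1 m2] := mh; split.
    rewrite (_ : (fun y => _) = (fun y => fine (K (g (k n)) y) - complex.Re (h y))%R).
      exact: measurable_funB.
    by apply/funext => y; rewrite /dl KG; case: (h y).
  rewrite (_ : (fun y => _) = (fun y => 0 - complex.Im (h y))%R).
    by apply: measurable_funB => //; exact: measurable_cst.
  by apply/funext => y; rewrite /dl KG; case: (h y).
pose c := (2 `^ q)%R : R.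
have c0 : (0 < c)%R by rewrite powR_gt0.
(* Pointwise, [K (g (k n))] is at most |dl n| + phi. Since n <= k n, the tail of index [k n] lies in
   that of index [n], so the tail of [phi] no longer depends on the subsequence. *)
have main n : e%:E < c%:E * (\int[mu]_y `|(ComplexField.Normc.normc (dl n y))%:E| `^ q +
    \int[mu]_(y in ~` middle l A n) (phi y `^ q)%:E).
  have [_ _ _ /lt_le_trans] := gP (k n); apply.
  have mD := measurable_middle_set mlA (k n); have mDc := measurableC mD.
  have mDn := measurableC (measurable_middle_set mlA n).
  have nd := mpow _ setT ((measurable_EFinP _ _).1 (measurable_normc (mdl n))).
  have np := mpow _ setT mphi.
  apply: (@le_trans _ _ (\int[mu]_(y in ~` middle l A (k n))
     (c%:E * ((ComplexField.Normc.normc (dl n y) `^ q)%:E + (phi y `^ q)%:E)))).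
    apply: ge0_le_integral => //.
    - by move=> *; exact: poweR_ge0.
    - apply: measurable_funTS; apply: measurable_poweR_comp.
      exact: measurable_hardy.
    - by apply/measurable_funTS/measurable_funeM; exact: emeasurable_funD.
    move=> y _.
    have KE : K (g (k n)) y = (fine (K (g (k n)) y))%:E.
      exact: (hardyE cA p1 M0 (mg (k n)) (g0 _) (gM _)).
    rewrite KE poweR_EFin -EFinD -EFinM lee_fin.
    apply: le_trans (powR_add_le (normc_ge0 _) (phi0 y) (ltW q0)).
    have K0 : (0 <= fine (K (g (k n)) y))%R by exact: fine_hardy_ge0.
    apply: ge0_ler_powR; rewrite ?nnegrE ?(ltW q0) ?addr_ge0 ?normc_ge0//.
    rewrite /phi; case: ifPn => [_|].
      have ReE : fine (K (g (k n)) y) = complex.Re (dl n y + h y)%R.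
        by rewrite /dl subrK KG.
      apply: le_trans (ler_norm _) _; rewrite ReE.
      by apply: le_trans (Re_le_normc _) _; exact: le_normcD.
    (* Where [l (A y)] is 0, the Hoelder bound forces [K (g (k n))] to vanish, so replacing [h] by
       [phi] loses nothing. *)
    rewrite -leNgt => Ay0.
    apply: le_trans (fine_hardy_le cA p1 M0 (mg (k n)) (g0 _) (gM _) y) _.
    have -> : l (A y) = 0 by apply/eqP; rewrite eq_le Ay0 measure_ge0.
    by rewrite powR0 ?mulr0 ?addr0 ?normc_ge0// gt_eqF// subr_gt0 invf_lt1// (lt_trans ltr01).
  have nd0 y : (~` middle l A (k n)) y -> 0 <= (ComplexField.Normc.normc (dl n y) `^ q)%:E.
    by move=> _; rewrite lee_fin powR_ge0.
  have np0 y : (~` middle l A (k n)) y -> 0 <= (phi y `^ q)%:E.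
    by move=> _; rewrite lee_fin powR_ge0.
  rewrite ge0_integralZl//; last 3 first.
  - by apply: measurable_funTS; exact: emeasurable_funD.
  - by move=> y yD; apply: adde_ge0; [exact: nd0|exact: np0].
  - by rewrite lee_fin ltW.
  rewrite lee_pmul2l// ge0_integralD//; last 2 first.
  - exact: measurable_funTS.
  - exact: measurable_funTS.
  apply: leeD.
    rewrite integral_normc_poweR; apply: ge0_subset_integral => //.
    by move=> *; rewrite lee_fin powR_ge0.
  apply: ge0_subset_integral => //.
  - exact: measurable_funTS.
  - by move=> *; rewrite lee_fin powR_ge0.
  - by apply: subsetC; exact: le_middle.
(* Dominated convergence with majorant phi^q: a point with [l (A y)] positive lies in all late
   middle sets because [l (A y)] is finite, and [phi] is 0 at the others. *)
have tail0 : \int[mu]_(y in ~` middle l A n) (phi y `^ q)%:E @[n --> \oo] --> 0.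
  under eq_fun do rewrite integral_mkcond.
  rewrite -(integral0 mu setT).
  apply: (@dominated_cvg _ _ _ mu _ measurableT _ _ (fun y => (phi y `^ q)%:E)) => //.
  - move=> n; apply/(measurable_restrictT _ (measurableC (measurable_middle_set mlA n))).
    exact: mpow.
  - move=> y _; apply: cvg_near_cst.
    have [Ay|Ay] := ltP 0 (l (A y)); last first.
      apply: nearW => n; rewrite patchE; case: ifPn => // _.
      by rewrite /phi ltNge Ay/= powR0// gt_eqF.
    have Afin := chain_fin_num cA y.
    have Ay0 : (0 < fine (l (A y)))%R by rewrite fine_gt0// Ay ltey_eq Afin.
    near=> n; rewrite patchE ifF//; apply/negbTE; rewrite notin_setE /=.
    apply; split; rewrite -(fineK Afin) ?lte_fin ?lee_fin.
      by near: n; exact: near_infty_natSinv_lt (PosNum Ay0).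
    rewrite (@le_trans _ _ n%:R)//; last by rewrite ler_nat.
    by near: n; exact: nbhs_infty_ger.
  - apply/integrableP; split; first exact: mpow.
    by under eq_integral do rewrite gee0_abs ?lee_fin ?powR_ge0//.
  - move=> n y _; rewrite patchE; case: ifPn => _.
      by rewrite gee0_abs// lee_fin powR_ge0.
    by rewrite abse0 lee_fin powR_ge0.
(* Two terms of this size make the right-hand side of [main] at most [e], against its strict
   inequality. *)
have d0 : (0 < e / (2 * c))%R by rewrite divr_gt0// mulr_gt0.
have I0 n : 0 <= \int[mu]_y `|(ComplexField.Normc.normc (dl n y))%:E| `^ q.
  by apply: integral_ge0 => *; exact: poweR_ge0.
have J0 n : 0 <= \int[mu]_(y in ~` middle l A n) (phi y `^ q)%:E.
  by apply: integral_ge0 => *; rewrite lee_fin powR_ge0.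
have nI := (cvge0P I0).1 cvh _ d0; have nJ := (cvge0P J0).1 tail0 _ d0.
have nIJ := filterI nI nJ; have [n [In Jn]] := filter_ex (nIJ _).
have := main n; apply/negP; rewrite -leNgt.
apply: (@le_trans _ _ (c%:E * ((e / (2 * c))%:E + (e / (2 * c))%:E))).
  by rewrite lee_pmul2l//; exact: leeD.
rewrite -EFinD -EFinM lee_fin le_eqVlt; apply/orP; left; apply/eqP.
by field; rewrite gt_eqF.
Unshelve. all: by end_near. Qed.

End compact_iff_vanishing_tails.

(** * Transfer of the tail condition to the normal form *)

Lemma exists_powR (R : realType) (z g q : R) : (0 < z)%R -> (0 < g)%R -> (0 < q)%R ->
  exists t : R, (0 < t)%R /\ ((t `^ g) `^ q = z)%R.
Proof.
move=> z0 g0 q0; exists (z `^ (g * q)^-1)%R; split; first exact: powR_gt0.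
have -> : ((z `^ (g * q)^-1) `^ g = z `^ ((g * q)^-1 * g))%R by rewrite powRrM.
have -> : ((z `^ ((g * q)^-1 * g)) `^ q = z `^ ((g * q)^-1 * g * q))%R.
  by rewrite (powRrM z ((g * q)^-1 * g)%R q).
rewrite -mulrA mulVf ?powRr1 ?ltW// mulf_neq0// gt_eqF//.
Qed.

Lemma ge0_integral_mrestr (R : realType) d (T : measurableType d)
    (mu : {measure set T -> \bar R}) (D : set T) (mD : measurable D)
    (f : T -> \bar R) : measurable_fun setT f -> (forall x, 0 <= f x) ->
  \int[mrestr mu mD]_x f x = \int[mu]_(x in D) f x.
Proof.
move=> mf f0; rewrite -[in LHS](setvU D) ge0_integral_setU//.
- rewrite null_set_integral ?add0e.
  + apply: eq_measure_integral => E mE ED.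
    by rewrite /= /mrestr setIidl.
  + exact: measurableC.
  + exact: measurable_funTS.
  + by rewrite /= /mrestr setICl measure0.
- exact: measurableC.
- by rewrite setvU.
- by apply/disj_setPS => x [].
Qed.

(** Puts a bound on a tail integral into the form of a norm bound for the restricted measure, to
    which the transfer lemmas apply. *)
Lemma Lnorm_mrestr_leP (R : realType) d (T : measurableType d)
    (mu : {measure set T -> \bar R}) (D : set T) (mD : measurable D) (q e : R)
    (u : T -> \bar R) : (0 < q)%R -> (0 <= e)%R ->
  measurable_fun setT u -> (forall x, 0 <= u x) ->
  (Lnorm (mrestr mu mD) q%:E u <= (e `^ q^-1)%:E) =
  (\int[mu]_(x in D) u x `^ q <= e%:E).
Proof.
move=> q0 e0 mfu u0; rewrite Lnorm_leP ?lee_fin ?powR_ge0// poweR_EFin.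
rewrite -powRrM mulVf ?gt_eqF// powRr1// ge0_integral_mrestr//.
- by under eq_integral do rewrite gee0_abs//.
- exact: measurable_abse_poweR.
- by move=> *; exact: poweR_ge0.
Qed.

Section compact_normal_form.
Context (R : realType) d (S : measurableType d) d' (Y : measurableType d').
Variables (lambda : {measure set S -> \bar R})
  (mu : {sigma_finite_measure set Y -> \bar R}).
Variables (B : Y -> set S) (hB : core_map lambda B).
Variables (p q : R).
Hypotheses (p1 : (1 < p)%R) (q0 : (0 < q)%R).

Let beta y := lambda (B y).
Let b := rearrangement mu beta.
Let K := hardy_operator lambda B.
Let H := normal_form_operator b.
Let m := lebesgue_pos R.
Let bpos := pos_rearrangement mu beta.
(** Presents H_b as a Hardy operator with index space the line, so that the compactness criterion
    applies to it too. *)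
Let A x : set (measurableTypeR R) := pos_itv (bpos x).
Let cB := core_map_chain hB.
Let mbeta := core_map_measurable_measure hB.
Let p0 : (0 < p)%R. Proof. by rewrite (lt_trans ltr01). Qed.
Let bpos0 x : 0 <= bpos x. Proof. exact: pos_rearrangement_ge0. Qed.
Let mA x : m (A x) = bpos x. Proof. by rewrite /m lebesgue_pos_pos_itv. Qed.

Lemma normal_form_hardy : H = hardy_operator m A.
Proof. by rewrite /H /b; apply/funext => f; rewrite normal_form_operator_rearrangement. Qed.

Variable C : R.
Hypotheses (C0 : (0 <= C)%R) (KC : norm_bound lambda mu K p%:E q%:E C%:E).

Let fin_beta (t : R) : (0 < t)%R -> mu [set y | t%:E < beta y] < +oo.
Proof. by move=> t0; apply: superlevel_finite KC. Qed.

(* If [b x = +oo] then [t^q x <= (C t^(1/p))^q] for all [t], absurd as [p > 1]. *)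
Lemma pos_rearrangement_finite x : bpos x < +oo.
Proof.
rewrite ltey; apply/eqP => bx.
have x0 : (0 < x)%R.
  by move: bx; rewrite /bpos /pos_rearrangement; case: ifPn.
have xlt (t : R) : (0 < t)%R -> x%:E < mu [set y | t%:E < beta y].
  move=> t0; rewrite -rearrangement_gt ?(ltW t0)//.
  by move: bx; rewrite /bpos /pos_rearrangement x0 => ->; rewrite ltry.
have g0 : (0 < 1 - p^-1)%R by rewrite subr_gt0 invf_lt1.
(* With t^((1-1/p)q) = D/x one gets t^q x = t^(q/p) D, and any [D] above C^q contradicts
   [superlevel_bound]. *)
pose D := (C `^ q + 1)%R.
have D0 : (0 < D)%R by rewrite ltr_wpDl// powR_ge0.
have Dx0 : (0 < D / x)%R by rewrite divr_gt0.
have [t [t0 tE]] : exists t : R, (0 < t)%R /\ ((t `^ (1 - p^-1)) `^ q = D / x)%R.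
  exact: exists_powR.
have := superlevel_bound cB mbeta p1 q0 C0 t0 KC.
apply/negP; rewrite -ltNge.
apply: (@lt_le_trans _ _ ((t `^ q)%:E * x%:E)); last first.
  apply: lee_wpmul2l; first by rewrite lee_fin powR_ge0.
  by apply: ltW; exact: xlt.
rewrite -EFinM lte_fin powRM ?powR_ge0//.
have tqE : (t `^ q = (t `^ p^-1) `^ q * (D / x))%R.
  rewrite -tE -powRM ?powR_ge0// -powRD; last by rewrite (gt_eqF t0) implybT.
  by rewrite (addrC p^-1%R) (subrK p^-1%R) powRr1// ltW.
rewrite tqE mulrC -mulrA ltr_pM2l ?powR_gt0// divfK ?gt_eqF//.
by rewrite /D ltrDl.
Qed.

Lemma pos_rearrangement_chain : chain m A.
Proof.
split => [x|x y|x]; first exact: measurable_pos_itv.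
  by have [h|/ltW h] := leP (bpos x) (bpos y); [left|right]; exact: pos_itvS.
by rewrite mA pos_rearrangement_finite.
Qed.

Let cA := pos_rearrangement_chain.

Lemma measurable_pos_rearrangement_measure :
  measurable_fun setT (fun x : measurableTypeR R => m (A x)).
Proof.
by under eq_fun do rewrite mA; exact: measurable_pos_rearrangement.
Qed.

Let mmA := measurable_pos_rearrangement_measure.

Let middleE n : middle m A n =
  [set x | (n.+1%:R^-1)%:E < bpos x /\ bpos x <= n.+1%:R%:E].
Proof. by apply/seteqP; split => x; rewrite /middle/= mA. Qed.

(** The finite total integral that [equimeasurable_tail] demands comes from the bound [KC], carried
    over to the normal form. *)
Let tail_integral (M : R) (f : measurableTypeR R -> \bar R) n :
  measurable_fun setT f -> (forall x, 0 <= f x) -> Lnorm m p%:E f <= M%:E ->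
  \int[mu]_(y in ~` middle lambda B n) primitive f (beta y) `^ q =
  \int[m]_(x in ~` middle m A n) hardy_operator m A f x `^ q.
Proof.
move=> mf f0 fM; rewrite middleE.
apply: (@equimeasurable_tail R _ _ _ _ mu m _ _ beta bpos) => //.
- exact: sigma_finiteT.
- exact: sigma_finite_lebesgue_pos.
- exact: measurable_pos_rearrangement.
- by move=> t t0; exact: pos_rearrangement_equimeasurable.
- exact: primitive_ge0.
- exact: primitive_ray_like.
have p1' : 1 <= p%:E by rewrite lee_fin ltW.
have q0' : 0 < q%:E by [].
have := (norm_bound_normal_form mu hB p1' q0' (C0 : 0 <= C%:E)).1 KC f mf f0
  (le_lt_trans fM (ltry _)).
rewrite (normal_form_Lnorm mu hB q0' mf f0) => /le_lt_trans h.
have : Lnorm mu q%:E (hardy_operator m (fun y => pos_itv (beta y)) f) < +oo.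
  apply: h; rewrite lte_mul_pinfty// ?lee_fin//.
  exact: le_lt_trans fM (ltry _).
rewrite Lnorm_lty//.
by under eq_integral do rewrite gee0_abs ?hardy_ge0//.
Qed.

(** The tail condition is a norm bound with constant e^(1/q) for [mu] restricted to the tail set,
    hence passes between [B] and the intervals over [Y]; [tail_integral] then moves it to the line.
    The same [n] serves on both sides. *)
Lemma vanishing_tails_normal_form :
  vanishing_tails lambda mu B p q <-> vanishing_tails m m A p q.
Proof.
have p1' : 1 <= p%:E by rewrite lee_fin ltW.
have q0' : 0 < q%:E by [].
have mD n := measurableC (measurable_middle_set mbeta n).
pose B' y : set (measurableTypeR R) := pos_itv (beta y).
have cB' : chain m B' := pos_itv_chain hB.
have mB' : measurable_fun setT (fun y => m (B' y)).
  by under eq_fun do rewrite pos_itv_measure.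
split => VT M e M0 e0; have [n nP] := VT M e M0 e0; exists n => g mg g0 gM.
- rewrite -(tail_integral n mg g0 gM).
  rewrite -[integral _ _ _]/(\int[mu]_(y in ~` middle lambda B n)
    hardy_operator m B' g y `^ q).
  rewrite -(Lnorm_mrestr_leP mu (mD n) q0 (ltW e0)); last 2 first.
  + exact: measurable_hardy.
  + by move=> y; exact: hardy_ge0.
  apply: (normal_form_le_hardy hB (p := p%:E)) => //.
    by rewrite lee_fin powR_ge0.
  move=> h mh h0 hg; rewrite Lnorm_mrestr_leP// ?(ltW e0)//.
  + by apply: nP => //; exact: le_trans gM.
  + exact: measurable_hardy.
  + by move=> y; exact: hardy_ge0.
- rewrite -(Lnorm_mrestr_leP mu (mD n) q0 (ltW e0)); last 2 first.
  + exact: measurable_hardy.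
  + by move=> y; exact: hardy_ge0.
  apply: (hardy_le_normal_form hB (p := p%:E)) => //.
    by rewrite lee_fin powR_ge0.
  move=> h mh h0 hg; rewrite Lnorm_mrestr_leP// ?(ltW e0)//.
  + have hM := le_trans hg gM.
    have := nP h mh h0 hM; rewrite -(tail_integral n mh h0 hM).
    exact.
  + exact: measurable_hardy.
  + by move=> y; exact: hardy_ge0.
Qed.

End compact_normal_form.

Lemma compact_operator_normal_form (R : realType)
    d (S : measurableType d) d' (Y : measurableType d')
    (lambda : {measure set S -> \bar R}) (mu : {sigma_finite_measure set Y -> \bar R})
    (B : Y -> set S) (hB : core_map lambda B) (p q : R) :
  (1 < p)%R -> (0 < q)%R ->
  let H := normal_form_operator (rearrangement mu (fun y => lambda (B y))) in
  let m := lebesgue_pos R in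
  compact_operator lambda mu (hardy_operator lambda B) p%:E q%:E <->
  compact_operator m m H p%:E q%:E.
Proof.
move=> p1 q0 H m.
have p1' : 1 <= p%:E by rewrite lee_fin ltW.
have q0' : 0 < q%:E by [].
have bb := bounded_operator_normal_form mu hB p1' q0'.
(* The transfer of tails works from a bound for K_B. Either compactness assumption provides one,
   that on H_b through [bb]. *)
have main : bounded_operator lambda mu (hardy_operator lambda B) p%:E q%:E ->
  compact_operator lambda mu (hardy_operator lambda B) p%:E q%:E <->
  compact_operator m m H p%:E q%:E.
  move=> bK; have [C C0 KC] := (bounded_hardyP mu hB p%:E q0').1 bK.
  have cA := pos_rearrangement_chain hB p1 q0 C0 KC.
  have mA := measurable_pos_rearrangement_measure mu hB.
  have VT := vanishing_tails_normal_form hB p1 q0 C0 KC.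
  have bH : bounded_operator m m H p%:E q%:E := bb.1 bK.
  have HE : H = _ := normal_form_hardy lambda mu B.
  have cB := core_map_chain hB.
  have mB := core_map_measurable_measure hB.
  rewrite HE in bH *; split => cK.
  - apply: (@vanishing_tails_compact R _ _ m _ (measurableTypeR R) m _ cA mA p q p1 q0 bH).
    by apply/VT; exact: (compact_vanishing_tails cB mB p1 q0 cK).
  - apply: (vanishing_tails_compact cB mB p1 q0 bK); apply/VT.
    exact: (@compact_vanishing_tails R _ _ m _ (measurableTypeR R) m _ cA mA p q p1 q0 cK).
by split => cK; apply/main => //; [case: cK|apply/bb; case: cK].
Qed.

Theorem theorem2p4 (R : realType)
    (d : measure_display) (S : measurableType d)
    (d' : measure_display) (Y : measurableType d')
    (lambda : {sigma_finite_measure set S -> \bar R})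
    (mu : {sigma_finite_measure set Y -> \bar R})
    (B : Y -> set S) (hB : core_map lambda B) :
  let b : R -> \bar R := rearrangement mu (fun y => lambda (B y)) in
  let K := hardy_operator lambda B in
  let H := normal_form_operator b in
  let m := lebesgue_pos R in
  [/\ normal_form_parameter b,
      forall p q : \bar R, 1 <= p -> 0 < q ->
        (bounded_operator lambda mu K p q <-> bounded_operator m m H p q) /\
        operator_norm lambda mu K p q = normal_form_norm p q b
    & forall p q : R, (1 < p)%R -> (p <= q)%R ->
        (compact_operator lambda mu K p%:E q%:E <->
         compact_operator m m H p%:E q%:E)].
Proof.
move=> b K H m; split.
- exact: normal_form_parameter_rearrangement.
- move=> p q p1 q0; split; last exact: operator_norm_normal_form.
  exact: bounded_operator_normal_form.
- move=> p q p1 pq; apply: compact_operator_normal_form => //.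
  exact: lt_le_trans (lt_trans ltr01 p1) pq.
Qed.
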